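(* Let $n,m\ge 1$, let $C\in\mathbb{C}^{n\times(n+m+1)}$ be a matrix of rank $n$, and let $A\in\mathbb{Z}_{\ge 0}^{(n+1)\times(n+m+1)}$ be a matrix of rank $n+1$ with pairwise distinct columns $(1,a_0),\dots,(1,a_{n+m})$, $a_j\in\mathbb{Z}_{\ge0}^n$. Assume that the system $C\cdot(x+\mathbf{1})^A=0$ is convenient and non-degenerate at $\mathbf{0}$, with local intersection multiplicity $\mu$ at the isolated solution $\mathbf{0}$. Then $$\mu\le(n+m)^n.$$
   Context: For $C=(c_{kj})$ and $A$ with columns $(1,a_j)$, $j=0,\dots,n+m$, the system $C\cdot(x+\mathbf{1})^A=0$ is the system of $n$ polynomials $F_k(x)=\sum_{j=0}^{n+m}c_{kj}\prod_{i=1}^n(x_i+1)^{a_{ij}}=0$, $k=1,\dots,n$, where $a_j=(a_{1j},\dots,a_{nj})$. Here $\mathbf{1}=(1,\dots,1)$ and $\mathbf{0}=(0,\dots,0)$. The local intersection multiplicity at an isolated solution is the complex dimension of the local ring at that point of the scheme defined by the $n$ equations. The Newton polytope $\Delta(F)$ of a polynomial $F$ is the convex hull of the exponents of monomials occurring in $F$ with non-zero coefficient. $F$ is convenient if $\Delta(F)$ intersects every coordinate axis of $\mathbb{R}^n$; a system is convenient if each of its polynomials is. A system $G_1=\cdots=G_n=0$ in $n$ variables having an isolated solution at $\mathbf{0}$ is non-degenerate at $\mathbf{0}$ if $G_1,\dots,G_n$ are convenient and, for every $\epsilon\in\mathbb{R}_{>0}^n$, the system $G_1^\epsilon=\cdots=G_n^\epsilon=0$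 has no common solution in $(\mathbb{C}^* )^n$, where $G_i^\epsilon$ is the sum of those terms of $G_i$ whose exponent $\alpha$ minimizes $\langle\epsilon,\alpha\rangle$. *)

(* Defs.v *)
(* Mathematical Components. The real numbers are an arbitrary [R : realType]
   and the complex numbers are [R[i]]. *)
From mathcomp Require Import all_boot all_order all_algebra.
From mathcomp Require Import mpoly complex.
From mathcomp Require Import boolp classical_sets reals constructive_ereal.

Set Implicit Arguments.
Unset Strict Implicit.
Unset Printing Implicit Defensive.

Import Order.TTheory GRing.Theory Num.Theory.

Local Open Scope classical_set_scope.
Local Open Scope ring_scope.

Section Systems.
Variables (R : realType) (n : nat).

Implicit Types (F : 'I_n -> {mpoly R[i][n]}) (G : {mpoly R[i][n]}).
Implicit Types p x : 'I_n -> R[i].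

(* The order on [R[i]] is partial: [0 < r] forces [r] to be real. *)
Definition isolated_solution F p : Prop :=
  (forall k, (F k).@[p] = 0) /\
  exists2 r : R[i], 0 < r &
    forall x, (forall i, `|x i - p i| < r) ->
      (forall k, (F k).@[x] = 0) -> x = p.

(* The local ring of affine space at [p], inside the field of rational
   functions. *)
Definition local_ring p : set {fraction {mpoly R[i][n]}} :=
  [set h | exists f g : {mpoly R[i][n]},
             g.@[p] != 0 /\ h = tofrac f / tofrac g].

Definition local_ideal F p : set {fraction {mpoly R[i][n]}} :=
  [set h | exists2 u : 'I_n -> {fraction {mpoly R[i][n]}},
             (forall k, local_ring p (u k)) &
             h = \sum_(k < n) u k * tofrac (F k)].

(* [local_ring p / local_ideal F p], the local ring at [p] of the scheme
   defined by [F], has a complex basis consisting of [d] elements, namely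
   the classes of the [e i]. *)
Definition local_algebra_has_dim F p (d : nat) : Prop :=
  exists2 e : 'I_d -> {fraction {mpoly R[i][n]}},
    (forall i, local_ring p (e i)) &
    forall h, local_ring p h ->
      exists! c : 'rV[R[i]]_d,
        local_ideal F p (h - \sum_(i < d) tofrac ((c 0 i)%:MP) * e i).

(* The complex dimension of that local ring, [+oo] if it is infinite. *)
Definition local_multiplicity F p : \bar R :=
  xget +oo%E [set (d%:R)%:E | d in local_algebra_has_dim F p].

Definition convex_hull (S : set 'rV[R]_n) : set 'rV[R]_n :=
  [set v | exists (k : nat) (w : 'I_k -> R) (s : 'I_k -> 'rV[R]_n),
             [/\ forall i, S (s i), forall i, 0 <= w i, \sum_(i < k) w i = 1
               & v = \sum_(i < k) w i *: s i]].

Definition exponent_vector (a : 'X_{1..n}) : 'rV[R]_n := \row_i (a i)%:R.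

Definition newton_polytope G : set 'rV[R]_n :=
  convex_hull [set exponent_vector a | a in [set a | a \in msupp G]].

Definition coordinate_axis (i : 'I_n) : set 'rV[R]_n :=
  [set v | forall j, j != i -> v 0 j = 0].

Definition convenient G : Prop :=
  forall i, newton_polytope G `&` coordinate_axis i !=set0.

Definition convenient_system F : Prop := forall k, convenient (F k).

Definition weight (eps : 'I_n -> R) (a : 'X_{1..n}) : R :=
  \sum_(i < n) eps i * (a i)%:R.

Definition initial_form (eps : 'I_n -> R) G : {mpoly R[i][n]} :=
  \sum_(a <- msupp G | all (fun b => weight eps a <= weight eps b) (msupp G))
    G@_a *: 'X_[a].

Definition nondegenerate_at_origin F : Prop :=
  [/\ isolated_solution F (fun _ => 0),
      convenient_system F
    & forall eps : 'I_n -> R, (forall i, 0 < eps i) ->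
        ~ exists2 x : 'I_n -> R[i], forall i, x i != 0 &
            forall k, (initial_form eps (F k)).@[x] = 0].

(* The system [C . (x + 1)^A]. Row [0] of [A] plays no role here; the rows
   with index [lift ord0 i] hold the exponents. *)
Definition shifted_system (N : nat) (C : 'M[R[i]]_(n, N))
    (A : 'M[nat]_(n.+1, N)) (k : 'I_n) : {mpoly R[i][n]} :=
  \sum_(j < N) C k j *: \prod_(i < n) ('X_i + 1) ^+ A (lift ord0 i) j.

End Systems.

(* Main.v *)
Require Import Defs.
From HB Require Import structures.
From mathcomp Require Import all_boot all_order all_algebra.
From mathcomp Require Import ring lra ssrcomplements mpoly complex spectral.
From mathcomp Require Import boolp classical_sets reals constructive_ereal.
From mathcomp Require Import filter.
From mathcomp.analysis Require Import topology normedtype sequences exp.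

Set Implicit Arguments.
Unset Strict Implicit.
Unset Printing Implicit Defensive.

Import Order.TTheory GRing.Theory Num.Theory.
Import numFieldNormedType.Exports.

Local Open Scope ring_scope.

(** Write [D = n + m].  On the [i]-th coordinate axis each equation is a
    polynomial in [x_i + 1] with at most [D + 1] terms, nonzero because the
    system is convenient; such a polynomial cannot vanish to order [D + 1] at
    [x_i = 0] ([fewnomial_eq0], [axis_order]).  So each equation contains a pure
    power of exponent at most [D] of each variable, and what remains is to bound
    by [D ^ n] the multiplicity at the origin of a non-degenerate system [F]
    with this property.

    Non-degeneracy turns this into a lower bound: near the origin some
    [|F_k x|] is at least [c * |x_i| ^ D] for all [i] ([lojasiewicz]).
    Otherwise the bound fails along a sequence of points of the torus tending to
    the origin.  The logarithms of the coordinates then determine, in the limit,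
    a positive weight and a point of the torus where all initial forms vanish
    ([no_bad_sequence]).

    Deform [F] to [G_s = F + s x ^ D + x ^ M] with [M] large
    ([deformation]).  By the lower bound, for small [s] the origin is the only
    zero of [G_s] near the origin ([no_small_zeros]).  The leading forms of
    [G_s] are the pure powers [x_k ^ M], so the monomials with all exponents
    below [M] form a basis of the quotient by [G_s] for every [s]
    ([normal_form_exists]) and the zeros of [G_s] have constant total
    multiplicity.  Hence no multiplicity leaves or reaches the origin as [s]
    tends to [0].  The proof makes this precise with a polynomial [E] that is
    idempotent modulo [G_0], with value [1] at the origin and [0] at the other
    zeros: the trace of the multiplication by [E] is a polynomial in [s], and it
    is the sum of the values of [E] at the zeros of [G_s], with multiplicities
    ([normal_form_family], [zeros_with_multiplicity]).  For all but finitely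
    many [s] the multiplicity of [G_s] at the origin is at most [D ^ n], since
    for large [s] the system is close to [x ^ D] up to the factor [s]
    ([codim_deformation]).  So it is at most [D ^ n] for [G_0] too.

    Modulo the [N]-th power of the maximal ideal of the origin, with [N <= M],
    the systems [F] and [G_0] agree.  Thus all quotients by the ideal of [F] and
    a power of the maximal ideal have dimension at most [D ^ n]
    ([codim_thickened]).  The chain of these quotients is therefore stationary,
    and by Nakayama's lemma the local algebra of [F] has dimension at most
    [D ^ n] as well ([local_multiplicity_le]). *)

(** * Normal forms modulo monic systems *)

Section LinearExtension.
Variables (n : nat) (A : comNzRingType) (V : lmodType A) (B : 'X_{1..n} -> V).

Definition lin_ext (f : {mpoly A[n]}) : V := \sum_(m <- msupp f) f@_m *: B m.

Lemma lin_extE f k : (msize f <= k)%N ->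
  lin_ext f = \sum_(m : 'X_{1..n < k}) f@_m *: B m.
Proof.
pose I : subFinType _ := 'X_{1..n < k}.
move=> le_fk; rewrite /lin_ext (big_mksub I) /=; first last.
- by move=> x /msize_mdeg_lt/leq_trans/(_ le_fk).
- by rewrite msupp_uniq.
by rewrite big_rmcond //= => j /memN_msupp_eq0 ->; rewrite scale0r.
Qed.

Lemma lin_ext_linear : linear lin_ext.
Proof.
move=> c f g; pose k := maxn (msize (c *: f + g)) (maxn (msize f) (msize g)).
rewrite (@lin_extE _ k) ?(@lin_extE f k) ?(@lin_extE g k) /k.
- rewrite scaler_sumr -big_split; apply: eq_bigr => m _ /=.
  by rewrite mcoeffD mcoeffZ scalerDl scalerA.
- by rewrite !leq_max leqnn !orbT.
- by rewrite !leq_max leqnn !orbT.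
- by rewrite leq_max leqnn.
Qed.

HB.instance Definition _ :=
  GRing.isLinear.Build A {mpoly A[n]} V _ lin_ext lin_ext_linear.

Lemma lin_extX m : lin_ext 'X_[m] = B m.
Proof. by rewrite /lin_ext msuppX big_seq1 mcoeffX eqxx scale1r. Qed.

End LinearExtension.

Section NormalForm.
Variables (n : nat) (A : comNzRingType).
Implicit Types (f g : {mpoly A[n]}) (G : 'I_n -> {mpoly A[n]}).

Lemma msizeM_leD f g a b :
  (msize f <= a.+1)%N -> (msize g <= b)%N -> (msize (f * g) <= a + b)%N.
Proof.
have [->|nz_f] := eqVneq f 0; first by rewrite mul0r msize0.
have [->|nz_g] := eqVneq g 0; first by rewrite mulr0 msize0.
have [->|nz_fg] := eqVneq (f * g) 0; first by rewrite msize0.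
rewrite -!mlead_deg // ltnS => le_fa lt_gb.
have /lemc_mdeg := mleadM_le f g; rewrite mdegD => /leq_ltn_trans; apply.
by rewrite -addnS leq_add.
Qed.

(** The size of a polynomial exceeds its degree by one: [f] and the monomial
    differ by terms of degree below that of [m]. *)
Definition leads f m := (msize (f - 'X_[m]) <= mdeg m)%N.

Lemma leads_size f m : leads f m -> (msize f <= (mdeg m).+1)%N.
Proof.
move=> fm; rewrite -[f](subrK 'X_[m]); apply: leq_trans (msizeD_le _ _) _.
by rewrite geq_max msizeX leqnn (leq_trans fm).
Qed.

Lemma leadsM f g m1 m2 : leads f m1 -> leads g m2 -> leads (f * g) (m1 + m2)%MM.
Proof.
move=> fm gm; rewrite /leads mpolyXD mdegD.
have -> : f * g - 'X_[m1] * 'X_[m2]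
        = f * (g - 'X_[m2]) + 'X_[m2] * (f - 'X_[m1]).
  by rewrite !mulrBr (mulrC 'X_[m2] f) addrA subrK (mulrC 'X_[m2]).
apply: leq_trans (msizeD_le _ _) _; rewrite geq_max.
rewrite (msizeM_leD (leads_size fm)) //= addnC msizeM_leD //.
by rewrite msizeX.
Qed.

Lemma leads1 : leads 1 0%MM.
Proof. by rewrite /leads mpolyX0 subrr msize0. Qed.

Lemma leadsX m : leads 'X_[m] m.
Proof. by rewrite /leads subrr msize0. Qed.

Lemma leads_exp f m k : leads f m -> leads (f ^+ k) (m *+ k)%MM.
Proof.
move=> fm; elim: k => [|k IHk]; first by rewrite expr0 mulm0n leads1.
by rewrite exprS mulmS leadsM.
Qed.

Lemma leads_prod (I : Type) (r : seq I) (F : I -> {mpoly A[n]}) m :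
  (forall i, leads (F i) (m i)) ->
  leads (\prod_(i <- r) F i) (\big[mnm_add/0%MM]_(i <- r) m i).
Proof.
move=> Fm; apply: (big_ind2 leads) => //; first exact: leads1.
by move=> *; exact: leadsM.
Qed.

(** [NF] reads off coordinates of the quotient of the polynomial ring by the
    ideal of [G] in the basis formed by the monomials [b j]. *)
Definition is_normal_form G (q : nat) (b : 'I_q -> 'X_{1..n})
    (NF : {linear {mpoly A[n]} -> 'rV[A]_q}) : Prop :=
  [/\ forall f k, NF (f * G k) = 0,
      forall f, exists u : 'I_n -> {mpoly A[n]},
        f = \sum_j NF f 0 j *: 'X_[b j] + \sum_k u k * G k
    & forall j, NF 'X_[b j] = delta_mx 0 j].

Variables (M : nat) (G : 'I_n -> {mpoly A[n]}).
Hypothesis M_gt0 : (0 < M)%N.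
Hypothesis leadsG : forall k, leads (G k) (U_(k) *+ M)%MM.

Let rem (m : 'X_{1..n}) := [multinom (m i %% M)%N | i < n].
Let quo (m : 'X_{1..n}) := [multinom (m i %/ M)%N | i < n].
Let prodG (m : 'X_{1..n}) := 'X_[rem m] * \prod_i G i ^+ (quo m i).
Local Notation Psi := (lin_ext prodG).

Let prodG_leads m : leads (prodG m) m.
Proof.
rewrite [X in leads _ X](_ : m = rem m + \sum_i (U_(i) *+ M) *+ quo m i)%MM.
  apply: leadsM; first exact: leadsX.
  by apply: leads_prod => i; apply: leads_exp.
apply/mnmP => i; rewrite mnmDE mnm_sumE (bigD1 i) //= big1 ?addn0.
  by rewrite !mulmnE !mnmE eqxx mul1n addnC mulnC -divn_eq.
by move=> j /negPf ne_ji; rewrite !mulmnE mnm1E ne_ji !mul0n.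
Qed.

(** [Psi] replaces the monomials by polynomials that they lead, so it is
    unitriangular for the degree; this makes it bijective. *)
Let Psi_size f : f != 0 -> (msize (f - Psi f) < msize f)%N.
Proof.
move=> nz_f; have sz_f : (0 < msize f)%N by rewrite lt0n msize_poly_eq0.
have -> : f - Psi f = \sum_(m <- msupp f) f@_m *: ('X_[m] - prodG m).
  by rewrite {1}[f]mpolyE /lin_ext -sumrB; apply: eq_bigr => *; rewrite scalerBr.
rewrite -(prednK sz_f) ltnS big_seq.
apply: (@big_ind _ (fun g => msize g <= (msize f).-1)%N).
- by rewrite msize0.
- by move=> g h sg sh; apply: leq_trans (msizeD_le _ _) _; rewrite geq_max sg.
move=> m /msize_mdeg_lt lt_mf; apply: leq_trans (msizeZ_le _ _) _.
rewrite -opprB msizeN -ltnS prednK //; apply: leq_ltn_trans lt_mf.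
exact: prodG_leads.
Qed.

Let Psi_surj f : exists g, Psi g = f.
Proof.
have [k] := ubnP (msize f); elim: k f => // k IHk f lt_fk.
have [->|nz_f] := eqVneq f 0; first by exists 0; rewrite raddf0.
have [|g Eg] := IHk (f - Psi f).
  by rewrite -ltnS; apply: leq_trans lt_fk; rewrite ltnS Psi_size.
by exists (f + g); rewrite raddfD /= Eg addrC subrK.
Qed.

Let Psi_inj g : Psi g = 0 -> g = 0.
Proof.
move=> g0; apply/eqP/negP => /negP /Psi_size.
by rewrite g0 subr0 ltnn.
Qed.

(** The polynomials [x^r G^q], with all exponents in [r] below [M], form a
    basis of the polynomial ring, being the monomials [x^(r + M q)] up to
    terms of lower degree.  The ideal of [G] is spanned by those with
    [q != 0], hence the others represent a basis of the quotient. *)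
Lemma normal_form_exists :
  exists q (b : 'I_q -> 'X_{1..n}) (NF : {linear {mpoly A[n]} -> 'rV[A]_q}),
    is_normal_form G b NF.
Proof.
pose T : finType := {ffun 'I_n -> 'I_M}.
pose b (j : 'I_#|T|) := [multinom (enum_val j i : nat) | i < n].
have b_inj : injective b.
  move=> i j /mnmP eq_ij; apply: enum_val_inj; apply/ffunP => k.
  by apply/val_inj; have := eq_ij k; rewrite !mnmE.
have rem_b j : rem (b j) = b j.
  by apply/mnmP => i; rewrite !mnmE modn_small.
have quo_b j : quo (b j) = 0%MM.
  by apply/mnmP => i; rewrite !mnmE divn_small.
have bP m : quo m = 0%MM -> exists j, m = b j.
  move=> /mnmP q0; have lt_mM i : (m i < M)%N.
    by rewrite [X in (X < _)%N](divn_eq _ M); have := q0 i;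
       rewrite !mnmE => ->; rewrite mul0n add0n ltn_pmod.
  exists (enum_rank ([ffun i => Ordinal (lt_mM i)] : T)).
  by apply/mnmP => i; rewrite mnmE enum_rankK ffunE.
have [Th ThK] := choice Psi_surj.
have Th_lin : linear Th.
  move=> c f g; apply/eqP; rewrite -subr_eq0; apply/eqP/Psi_inj.
  by rewrite raddfB /= linearP /= !ThK subrr.
have ThP f g : Psi g = f -> Th f = g.
  move=> Eg; apply/eqP; rewrite -subr_eq0; apply/eqP/Psi_inj.
  by rewrite raddfB /= ThK Eg subrr.
have [NF NF_prodG] : exists NF : {linear {mpoly A[n]} -> 'rV[A]_#|T|},
    forall m, NF (prodG m) = \row_j (m == b j)%:R.
  pose NF f : 'rV[A]_#|T| := \row_j (Th f)@_(b j).
  have NF_lin : linear NF.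
    by move=> c f g; apply/rowP => j; rewrite !mxE Th_lin mcoeffD mcoeffZ.
  pose NFl : {linear {mpoly A[n]} -> 'rV[A]_#|T|} :=
    HB.pack NF (GRing.isLinear.Build _ _ _ _ NF NF_lin).
  exists NFl => m; rewrite /NFl /=.
  apply/rowP => j; rewrite !mxE (ThP _ 'X_[m]) ?mcoeffX //.
  by rewrite lin_extX.
have prodGM m k : prodG m * G k = prodG (m + U_(k) *+ M)%MM.
  rewrite /prodG -mulrA; congr (_ * _).
    by congr 'X_[_]; apply/mnmP => i; rewrite !mnmE mulmnE addnC modnMDl.
  rewrite (bigD1 k) //= [RHS](bigD1 k) //= mulrAC -exprSr; congr (_ ^+ _ * _).
    by rewrite !mnmE mulmnE mnm1E eqxx mul1n divnDr // divnn M_gt0 addn1.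
  apply: eq_bigr => i /negPf ne_ik.
  by rewrite !mnmE mulmnE mnm1E eq_sym ne_ik addn0.
exists #|T|, b, NF; split.
- move=> f k; have [g <-] := Psi_surj f.
  rewrite /lin_ext mulr_suml raddf_sum big1 //= => m _.
  rewrite -scalerAl linearZ /= prodGM NF_prodG.
  apply/rowP => j; rewrite !mxE; case: eqP => [Em|_]; last by rewrite mulr0.
  have := quo_b j; rewrite -Em => /mnmP/(_ k).
  by rewrite !mnmE mulmnE mnm1E eqxx mul1n divnDr // divnn M_gt0 addn1.
- move=> f; have [g <-] := Psi_surj f; rewrite /lin_ext.
  apply: (@big_ind _ (fun f => exists u : 'I_n -> {mpoly A[n]},
    f = \sum_j NF f 0 j *: 'X_[b j] + \sum_k u k * G k)).
  + exists (fun=> 0); rewrite raddf0.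
    by rewrite !big1 ?addr0 // => i _; rewrite ?mul0r // mxE scale0r.
  + move=> f1 f2 [u1 E1] [u2 E2]; exists (fun k => u1 k + u2 k).
    rewrite {1}E1 {1}E2 addrACA -!big_split; congr (_ + _).
      apply: eq_bigr => j _; by rewrite raddfD mxE scalerDl.
    by apply: eq_bigr => k _; rewrite mulrDl.
  move=> m _; set c := g@_m.
  have NFm : NF (c *: prodG m) = c *: \row_j (m == b j)%:R.
    by rewrite linearZ /= NF_prodG.
  have [q0|/eqP] := quo m =P 0%MM.
    have [j Ej] := bP _ q0; exists (fun=> 0).
    rewrite [X in _ + X]big1 => [|k _]; last by rewrite mul0r.
    rewrite NFm addr0 (bigD1 j) //= big1 => [|i ne_ij]; last first.
      by rewrite !mxE Ej (inj_eq b_inj) eq_sym (negPf ne_ij) mulr0 scale0r.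
    rewrite addr0 !mxE -Ej eqxx mulr1; congr (_ *: _).
    by rewrite /prodG q0 Ej rem_b big1 ?mulr1 // => i _; rewrite mnm0E expr0.
  move=> q_neq0; have [k qk] : exists k, quo m k != 0%N.
    apply/existsP; rewrite -negb_forall; apply: contra q_neq0 => /forallP q0.
    by apply/eqP/mnmP => i; rewrite (eqP (q0 i)) mnm0E.
  have le_Mm : (U_(k) *+ M <= m)%MM.
    apply/mnm_lepP => i; rewrite mulmnE mnm1E.
    case: eqP => [<-|_]; last by rewrite mul0n.
    by move: qk; rewrite mnmE -lt0n divn_gt0 // mul1n.
  exists (fun i => if i == k then c *: prodG (m - U_(k) *+ M)%MM else 0).
  rewrite [X in X + _]big1 => [|j _]; last first.
    rewrite NFm !mxE; case: eqP => [Em|_]; last by rewrite mulr0 scale0r.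
    by move: qk; rewrite Em quo_b mnm0E.
  rewrite add0r (bigD1 k) //= eqxx big1 => [|i /negPf->]; last by rewrite mul0r.
  by rewrite addr0 -scalerAl prodGM submK.
- move=> j; have -> : 'X_[b j] = prodG (b j).
    by rewrite /prodG rem_b quo_b big1 ?mulr1 // => i _; rewrite mnm0E expr0.
  rewrite NF_prodG; apply/rowP => i; rewrite !mxE (inj_eq b_inj) eq_sym.
  by rewrite eqxx.
Qed.
End NormalForm.

(** * Ideals and multiplication matrices *)

Section Ideals.
Variables (n : nat) (A : comNzRingType).
Implicit Types (f g : {mpoly A[n]}).

Definition in_ideal (G : 'I_n -> {mpoly A[n]}) f : Prop :=
  exists u : 'I_n -> {mpoly A[n]}, f = \sum_k u k * G k.

Variable G : 'I_n -> {mpoly A[n]}.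

Lemma in_ideal0 : in_ideal G 0.
Proof. by exists (fun=> 0); rewrite big1 // => k _; rewrite mul0r. Qed.

Lemma in_idealD f g : in_ideal G f -> in_ideal G g -> in_ideal G (f + g).
Proof.
move=> [u ->] [v ->]; exists (fun k => u k + v k).
by rewrite -big_split; apply: eq_bigr => k _; rewrite mulrDl.
Qed.

Lemma in_idealMl f g : in_ideal G g -> in_ideal G (f * g).
Proof.
move=> [u ->]; exists (fun k => f * u k).
by rewrite mulr_sumr; apply: eq_bigr => k _; rewrite mulrA.
Qed.

Lemma in_idealMr f g : in_ideal G f -> in_ideal G (f * g).
Proof. by rewrite mulrC; exact: in_idealMl. Qed.

Lemma in_idealN f : in_ideal G f -> in_ideal G (- f).
Proof. by rewrite -mulN1r; exact: in_idealMl. Qed.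

Lemma in_idealB f g : in_ideal G f -> in_ideal G g -> in_ideal G (f - g).
Proof. by move=> If Ig; apply: in_idealD => //; apply: in_idealN. Qed.

Lemma in_idealZ c f : in_ideal G f -> in_ideal G (c *: f).
Proof. by rewrite -mul_mpolyC; exact: in_idealMl. Qed.

Lemma in_ideal_sum (I : Type) (r : seq I) (F : I -> {mpoly A[n]}) :
  (forall i, in_ideal G (F i)) -> in_ideal G (\sum_(i <- r) F i).
Proof.
move=> IF; apply: (big_ind (in_ideal G)) => //; first exact: in_ideal0.
exact: in_idealD.
Qed.

Lemma in_ideal_gen k : in_ideal G (G k).
Proof.
exists (fun j => (j == k)%:R); rewrite (bigD1 k) //= eqxx mul1r big1 ?addr0 //.
by move=> j /negPf->; rewrite mul0r.
Qed.

(** The [N]-th power of the maximal ideal of the origin. *)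
Definition ord_ge N f := forall m, (mdeg m < N)%N -> f@_m = 0.

(** The sum of the ideal of [G] and the [N]-th power of the maximal ideal of
    the origin. *)
Definition thickened N f := exists2 g, ord_ge N g & in_ideal G (f - g).

(** Over a field and for a subspace [J]: the quotient by [J] has dimension
    at most [d]. *)
Definition codim_le (J : {mpoly A[n]} -> Prop) d :=
  exists e : 'I_d -> {mpoly A[n]},
    forall f, exists c : 'I_d -> A, J (f - \sum_i c i *: e i).

Lemma ord_ge0 N : ord_ge N 0.
Proof. by move=> m _; rewrite mcoeff0. Qed.

Lemma ord_geD N f g : ord_ge N f -> ord_ge N g -> ord_ge N (f + g).
Proof. by move=> Nf Ng m lt_mN; rewrite mcoeffD Nf ?Ng ?addr0. Qed.

Lemma ord_geM N N' f g : ord_ge N f -> ord_ge N' g -> ord_ge (N + N') (f * g).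
Proof.
move=> Nf Ng m lt_m; rewrite mcoeffM big1 // => -[k1 k2] /= /eqP Em.
have [lt1|ge1] := ltnP (mdeg k1) N; first by rewrite Nf // mul0r.
rewrite Ng ?mulr0 // -(ltn_add2l N); apply: leq_ltn_trans lt_m.
apply: leq_trans (eq_leq (esym (congr1 mdeg Em))).
by rewrite mdegD leq_add2r.
Qed.

Lemma ord_ge_exp N k f : ord_ge N f -> ord_ge (k * N) (f ^+ k).
Proof.
move=> Nf; elim: k => [|k IHk]; first by move=> m; rewrite mul0n.
by rewrite exprS mulSn; exact: ord_geM.
Qed.

Lemma meval_origin f : f.@[fun=> 0] = f@_0%MM.
Proof.
rewrite [f]mpolyE !raddf_sum; apply: eq_bigr => m _ /=.
rewrite mevalZ mcoeffZ mevalX mcoeffX; congr (_ * _).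
have [->|/eqP nz_m] := eqVneq m 0%MM.
  by rewrite big1 // => i _; rewrite mnm0E expr0.
have [i mi] : exists i, m i != 0%N.
  apply/existsP; rewrite -negb_forall; apply: contra_notN nz_m => /forallP z.
  by apply/mnmP => i; rewrite mnm0E (eqP (z i)).
by rewrite (bigD1 i) //= expr0n (negPf mi) mul0r.
Qed.

Lemma ord_ge1 f : f.@[fun=> 0] = 0 -> ord_ge 1 f.
Proof.
by move=> f0 m; rewrite ltnS leqn0 mdeg_eq0 => /eqP->; rewrite -meval_origin.
Qed.
End Ideals.

Section MultiplicationMatrix.
Variables (n : nat) (A : comNzRingType) (G : 'I_n -> {mpoly A[n]}).
Variables (q : nat) (b : 'I_q -> 'X_{1..n}).
Variable NF : {linear {mpoly A[n]} -> 'rV[A]_q}.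
Implicit Types f g : {mpoly A[n]}.

(** The matrix, acting on row vectors, of the multiplication by [f] on the
    quotient with coordinates [NF]. *)
Definition mult_mx f : 'M[A]_q := \matrix_(i < q) NF ('X_[b i] * f).

Lemma row_mult_mx i f : row i (mult_mx f) = NF ('X_[b i] * f).
Proof. exact: rowK. Qed.

Lemma mult_mx_linear : linear mult_mx.
Proof.
move=> c f g; apply/row_matrixP => i.
by rewrite linearP /= !row_mult_mx mulrDr -scalerAr linearP.
Qed.
HB.instance Definition _ :=
  GRing.isLinear.Build A {mpoly A[n]} 'M[A]_q _ mult_mx mult_mx_linear.

Hypothesis NFP : is_normal_form G b NF.

Lemma NF_ideal f : in_ideal G f -> NF f = 0.
Proof.
case: NFP => NFG _ _ [u ->]; rewrite raddf_sum big1 // => k _; exact: NFG.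
Qed.

Lemma NF_repr f : in_ideal G (f - \sum_j NF f 0 j *: 'X_[b j]).
Proof.
by case: NFP => _ /(_ f)[u Ef] _; exists u; rewrite {1}Ef addrAC subrr add0r.
Qed.

Lemma NF_mul f g : NF (f * g) = NF f *m mult_mx g.
Proof.
rewrite -[f in LHS](subrK (\sum_j NF f 0 j *: 'X_[b j])) mulrDl raddfD /=.
rewrite NF_ideal ?add0r; last by apply: in_idealMr; apply: NF_repr.
rewrite mulmx_sum_row mulr_suml raddf_sum; apply: eq_bigr => j _ /=.
by rewrite -scalerAl linearZ /= row_mult_mx.
Qed.

Lemma NF_eq0 f : NF f = 0 -> in_ideal G f.
Proof.
by move=> f0; have := NF_repr f; rewrite f0 big1 ?subr0 // => j _;
   rewrite mxE scale0r.
Qed.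

Lemma mult_mxM f g : mult_mx (f * g) = mult_mx f *m mult_mx g.
Proof.
apply/row_matrixP => i.
by rewrite row_mul !row_mult_mx mulrA NF_mul.
Qed.

Lemma mult_mx1 : mult_mx 1 = 1%:M.
Proof.
by apply/row_matrixP => i; rewrite row_mult_mx mulr1 row1; case: NFP.
Qed.

Lemma mult_mx_eq0 f : mult_mx f = 0 -> in_ideal G f.
Proof. by move=> f0; apply: NF_eq0; rewrite -[f]mul1r NF_mul f0 mulmx0. Qed.

Lemma mult_mx_ideal f : in_ideal G f -> mult_mx f = 0.
Proof.
move=> If; apply/row_matrixP => i; rewrite row_mult_mx row0 NF_ideal //.
exact: in_idealMl.
Qed.
End MultiplicationMatrix.

Section TriangularMatrices.
Variables (K : comNzRingType) (q : nat).
Implicit Types T : 'M[K]_q.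

Lemma trig_mulmx T1 T2 : is_trig_mx T1 -> is_trig_mx T2 ->
  is_trig_mx (T1 *m T2) /\ forall a, (T1 *m T2) a a = T1 a a * T2 a a.
Proof.
move=> /is_trig_mxP t1 /is_trig_mxP t2; split.
  apply/is_trig_mxP => i j lt_ij; rewrite mxE big1 // => l _.
  have [lt_il|le_li] := ltnP i l; first by rewrite t1 ?mul0r.
  by rewrite t2 ?mulr0 // (leq_ltn_trans le_li).
move=> a; rewrite mxE (bigD1 a) //= big1 ?addr0 // => l.
rewrite neq_ltn => /orP[lt_la|lt_al]; first by rewrite t2 ?mulr0.
by rewrite t1 ?mul0r.
Qed.

End TriangularMatrices.

Section Points.
Variables (K : numClosedFieldType) (n : nat) (G : 'I_n -> {mpoly K[n]}).
Variables (q : nat) (b : 'I_q -> 'X_{1..n}).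
Variable NF : {linear {mpoly K[n]} -> 'rV[K]_q}.
Hypothesis NFP : is_normal_form G b NF.
Implicit Types f g : {mpoly K[n]}.
Local Notation mul := (mult_mx b NF).

(** The commuting multiplication matrices have a common triangular form,
    whose diagonals list the coordinates of the zeros of [G] with
    multiplicity. A polynomial that vanishes at all zeros has a strictly
    triangular matrix, hence is nilpotent modulo [G]. *)
Lemma zeros_with_multiplicity : exists p : 'I_q -> 'I_n -> K,
  [/\ forall a k, (G k).@[p a] = 0,
      forall f, \tr (mul f) = \sum_a f.@[p a]
    & forall f, (forall a, f.@[p a] = 0) -> in_ideal G (f ^+ q)].
Proof.
pose Xs := [seq mul 'X_i | i <- enum 'I_n].
have [|P Pu /allP trigP] := @cotrigonalization K q Xs.
  move=> _ _ /mapP[i _ ->] /mapP[j _ ->].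
  by rewrite /comm_mx -!(mult_mxM NFP) mulrC.
have {}Pu := unitarymx_unit Pu.
pose T f := P *m mul f *m invmx P.
have TM f g : T (f * g) = T f *m T g.
  by rewrite /T (mult_mxM NFP) !mulmxA mulmxKV.
have T_ideal f : in_ideal G f -> T f = 0.
  by move=> /(mult_mx_ideal NFP) f0; rewrite /T f0 mulmx0 mul0mx.
have TX i : is_trig_mx (T 'X_i).
  rewrite /T -conjumx //; apply: (trigP (mul 'X_i)).
  by apply: map_f; rewrite mem_enum.
pose p a i := T 'X_i a a.
have Tdiag f : is_trig_mx (T f) /\ forall a, T f a a = f.@[p a].
  have T1 : T 1 = 1%:M by rewrite /T (mult_mx1 NFP) mulmx1 mulmxV.
  pose good f := is_trig_mx (T f) /\ forall a, T f a a = f.@[p a].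
  have goodM g h : good g -> good h -> good (g * h).
    move=> [gt gd] [ht hd]; have [ght ghd] := trig_mulmx gt ht.
    by split=> [|a]; rewrite TM // ghd gd hd mevalM.
  have good1 : good 1.
    split=> [|a]; rewrite T1 ?scalar_mx_is_trig //.
    by rewrite mxE eqxx meval1.
  elim/mpolyind: f => [|c m f _ _ [ft fd]].
    rewrite T_ideal; last exact: in_ideal0.
    by split=> [|a]; rewrite ?mx0_is_trig // mxE meval0.
  have [mt md] : good 'X_[m].
    rewrite mpolyXE_id; apply: big_ind => // i _.
    elim: (m i) => [|k IHk] //; rewrite exprS; apply: goodM => //.
    by split=> // a; rewrite mevalXU.
  have TD i j : T (c *: 'X_[m] + f) i j = c * T 'X_[m] i j + T f i j.
    rewrite /T linearP /= mulmxDr mulmxDl -scalemxAr -scalemxAl mxE.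
    by rewrite [X in X + _]mxE.
  split=> [|a]; last by rewrite TD md fd mevalD mevalZ.
  apply/is_trig_mxP => i j lt_ij; rewrite TD.
  by rewrite (is_trig_mxP mt) // (is_trig_mxP ft) // mulr0 addr0.
exists p; split.
- move=> a k; rewrite -(Tdiag _).2 T_ideal ?mx0E; [by rewrite mxE|exact: in_ideal_gen].
- move=> f; have -> : \tr (mul f) = \tr (T f).
    by rewrite /T mxtrace_mulC mulKmx.
  by apply: eq_bigr => a _; exact: (Tdiag _).2.
move=> f f0; apply: (mult_mx_eq0 NFP).
(* The nonzero entries of the [k]-th power of a strictly triangular matrix
   lie at least [k] steps below the diagonal. *)
have Tpow k (i j : 'I_q) : (i < j + k)%N -> T (f ^+ k) i j = 0.
  elim: k i j => [|k IHk] i j.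
    by rewrite addn0 => lt_ij; rewrite (is_trig_mxP (Tdiag _).1).
  rewrite addnS ltnS => le_ij; rewrite exprSr TM mxE big1 // => l _.
  have [lt_ilk|le_lki] := ltnP i (l + k); first by rewrite IHk ?mul0r.
  have : (l <= j)%N by rewrite -(leq_add2r k) (leq_trans le_lki).
  rewrite leq_eqVlt => /orP[/eqP/val_inj->|lt_lj].
    by rewrite (Tdiag f).2 f0 mulr0.
  by rewrite [T f l j](is_trig_mxP (Tdiag f).1) ?mulr0.
have : T (f ^+ q) = 0.
  by apply/matrixP => i j; rewrite [RHS]mxE Tpow // ltn_addl.
rewrite /T => /(canRL (mulmxKV Pu)); rewrite mul0mx => /(canRL (mulKmx Pu)).
by rewrite mulmx0.
Qed.

Variable p : 'I_q -> 'I_n -> K.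
Hypothesis trp : forall f, \tr (mul f) = \sum_a f.@[p a].
Hypothesis nilp : forall f, (forall a, f.@[p a] = 0) -> in_ideal G (f ^+ q).

Definition at_origin : pred 'I_q := [pred a | [forall i, p a i == 0]].

(** The product [e] of affine forms has value [1] at the origin and [0] at
    the other zeros, so [e * (1 - e)] is nilpotent modulo [G]; then
    [1 - (1 - e ^ q) ^ q] is idempotent modulo [G] and takes the same values
    at the zeros. *)
Lemma origin_idempotent : (0 < q)%N -> exists E : {mpoly K[n]},
  [/\ E.@[fun=> 0] = 1, in_ideal G (E * (1 - E)),
      forall a, E.@[p a] = (at_origin a)%:R
    & forall i, in_ideal G (('X_i * E) ^+ q)].
Proof.
move=> q_gt0.
have /choice[c cP] a : exists i0 : option 'I_n,
    if i0 is Some i then p a i != 0 else at_origin a.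
  have [a0|/forallPn[i nz]] := boolP (at_origin a); first by exists None.
  by exists (Some i).
pose e := \prod_a (if c a is Some i then 1 - (p a i)^-1 *: 'X_i else 1).
have e0 : e.@[fun=> 0] = 1.
  rewrite /e rmorph_prod big1 //= => a _; case: (c a) => [i|]; last exact: meval1.
  by rewrite mevalB mevalZ mevalXU mulr0 meval1 subr0.
have ep a : e.@[p a] = (at_origin a)%:R.
  have [/forallP a0|a1] := boolP (at_origin a).
    by rewrite -[RHS]e0; apply: meval_eq => i; exact/eqP.
  rewrite /e rmorph_prod (bigD1 a) //=; move: (cP a).
  case: (c a) => [i nz|]; last by rewrite (negPf a1).
  by rewrite mevalB mevalZ mevalXU mulVf // meval1 subrr mul0r.
pose E := 1 - (1 - e ^+ q) ^+ q.
have nil_e : in_ideal G (e ^+ q * (1 - e) ^+ q).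
  rewrite -exprMn; apply: nilp => a; rewrite mevalM mevalB meval1 ep.
  by case: at_origin; rewrite ?subrr ?mulr0 ?mul0r.
have E01 v : E.@[v] = 1 - (1 - e.@[v] ^+ q) ^+ q.
  by rewrite /E mevalB meval1 rmorphXn /= mevalB meval1 rmorphXn.
have Ep a : E.@[p a] = (at_origin a)%:R.
  rewrite E01 ep; case: at_origin.
    by rewrite expr1n subrr expr0n eqn0Ngt q_gt0 subr0.
  by rewrite expr0n eqn0Ngt q_gt0 subr0 expr1n subrr.
exists E; split=> //.
- by rewrite E01 e0 expr1n subrr expr0n eqn0Ngt q_gt0 subr0.
- have sub1X z : exists S, 1 - z ^+ q = (1 - z) * S :> {mpoly K[n]}.
    by eexists; rewrite -{1}(expr1n _ q) subrXX.
  have [S1 ES1] := sub1X (1 - e ^+ q); have [S2 ES2] := sub1X e.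
  rewrite /E subKr ES1 subKr ES2 exprMn.
  rewrite mulrAC mulrA -mulrA; apply: in_idealMr; exact: nil_e.
move=> i; apply: nilp => a; rewrite mevalM mevalXU Ep.
have [/forallP/(_ i)/eqP->|_] := boolP (at_origin a); first by rewrite mul0r.
by rewrite mulr0.
Qed.

End Points.

(** In a full rank factorisation [T = C *m B] of an idempotent, [B *m C] is
    the identity matrix of size the rank. *)
Lemma mxtrace_idempotent (K : fieldType) (q : nat) (T : 'M[K]_q) :
  T *m T = T -> \tr T = (\rank T)%:R.
Proof.
move=> TT; have cr : row_base T *m col_base T = 1%:M.
  apply: (row_free_inj (row_base_free T)); apply: (row_full_inj (col_base_full T)).
  rewrite mul1mx (mulmxA _ (_ *m _)) (mulmxA (col_base T)) mulmx_base.
  by rewrite -mulmxA mulmx_base TT.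
by rewrite -{1}(mulmx_base T) mxtrace_mulC cr mxtrace1.
Qed.

(** * The local algebra at the origin *)

Section LocalDimension.
Variables (K : numClosedFieldType) (n : nat) (G : 'I_n -> {mpoly K[n]}).
Variables (q : nat) (b : 'I_q -> 'X_{1..n}).
Variable NF : {linear {mpoly K[n]} -> 'rV[K]_q}.
Hypothesis NFP : is_normal_form G b NF.
Implicit Types f g : {mpoly K[n]}.
Local Notation mul := (mult_mx b NF).
Variable E : {mpoly K[n]}.
Hypothesis E0 : E.@[fun=> 0] = 1.
Hypothesis EE : in_ideal G (E * (1 - E)).

Lemma rank_idempotent : \tr (mul E) = (\rank (mul E))%:R.
Proof.
apply: mxtrace_idempotent; rewrite -(mult_mxM NFP); apply/esym/eqP.
rewrite -subr_eq0 -raddfB /= (_ : E - E * E = E * (1 - E)); last by ring.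
by rewrite (mult_mx_ideal NFP).
Qed.

(** Modulo [G], [1 - E] equals its powers, and it vanishes at the origin;
    hence it lies in the ideal of [G] plus any power of the maximal ideal,
    and the range of [E] spans modulo this sum. *)
Lemma codim_le_rank N : codim_le (thickened G N) (\rank (mul E)).
Proof.
pose e i := \sum_j row_base (mul E) i j *: 'X_[b j].
exists e => f.
have /submxP[c Ec] : (NF (f * E)%R <= row_base (mul E))%MS.
  by rewrite (NF_mul NFP) eq_row_base submxMl.
have EN : in_ideal G ((1 - E) ^+ N.+1 - (1 - E)).
  elim: N => [|N IHN]; first by rewrite expr1 subrr; exact: in_ideal0.
  have -> : (1 - E) ^+ N.+2 - (1 - E)
      = (1 - E) * ((1 - E) ^+ N.+1 - (1 - E)) - E * (1 - E).
    by rewrite (exprS _ N.+1); ring.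
  by apply: in_idealB => //; apply: in_idealMl.
exists (c 0); exists (f * (1 - E) ^+ N.+1).
  rewrite -[N]add0n; apply: ord_geM; first by move=> m.
  move=> m lt_mN; apply: (@ord_ge_exp _ _ 1 N.+1 (1 - E)); last first.
    by rewrite muln1 leqW.
  by apply/ord_ge1; rewrite mevalB meval1 E0 subrr.
have -> : \sum_i c 0 i *: e i = \sum_j NF (f * E) 0 j *: 'X_[b j].
  rewrite Ec mulmx_sum_row; under eq_bigr do rewrite scaler_sumr.
  rewrite exchange_big; apply: eq_bigr => j _ /=.
  rewrite summxE scaler_suml; apply: eq_bigr => i _.
  by rewrite !mxE scalerA.
set S := \sum_j _; set F := (1 - E) ^+ N.+1.
have -> : f - S - f * F = (f * E - S) - f * (F - (1 - E)) by ring.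
apply: in_idealB; first exact: NF_repr NFP _.
exact: in_idealMl.
Qed.

(** Multiplication by [E] sends a power of the maximal ideal into the ideal of
    [G], hence a set spanning modulo that power spans the range of [E]. *)
Lemma rank_le_codim N d : (0 < q)%N -> (n * q < N)%N ->
  (forall i, in_ideal G (('X_i * E) ^+ q)) ->
  codim_le (thickened G N) d -> (\rank (mul E) <= d)%N.
Proof.
move=> q_gt0 lt_N nilE [e eP].
have EEq k : in_ideal G (E - E ^+ k.+1).
  elim: k => [|k IHk]; first by rewrite expr1 subrr; exact: in_ideal0.
  have -> : E - E ^+ k.+2 = E * (1 - E) + E * (E - E ^+ k.+1).
    by rewrite !mulrBr mulr1 -exprS addrA subrK.
  by apply: in_idealD => //; apply: in_idealMl.
have killX m : (N <= mdeg m)%N -> in_ideal G ('X_[m] * E).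
  move=> le_Nm; have [i le_qi] : exists i, (q <= m i)%N.
    apply/existsP; rewrite -[X in is_true X]negbK negb_exists.
    apply/negP => /forallP small.
    move: lt_N; rewrite ltnNge (leq_trans le_Nm) // mdegE.
    rewrite -[X in (_ <= X * _)%N]card_ord -sum_nat_const; apply: leq_sum => i _.
    by rewrite ltnW // ltnNge.
  have -> : 'X_[m] * E = 'X_[m] * (E - E ^+ q)
      + 'X_[m - U_(i) *+ q] * ('X_i * E) ^+ q.
    rewrite exprMn mulrA mpolyXn -mpolyXD submK ?mulrBr ?subrK //.
    apply/mnm_lepP => j; rewrite mulmnE mnm1E.
    by case: eqP => [<-|_]; rewrite ?mul1n ?mul0n.
  by apply: in_idealD; apply: in_idealMl => //; rewrite -(prednK q_gt0).
have kill f : ord_ge N f -> in_ideal G (f * E).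
  move=> ordf; rewrite [f]mpolyE mulr_suml; apply: in_ideal_sum => m.
  have [lt_mN|le_Nm] := ltnP (mdeg m) N.
    by rewrite ordf // scale0r mul0r; exact: in_ideal0.
  by rewrite -scalerAl; apply: in_idealZ; exact: killX.
pose W := \matrix_(i < d) NF (e i * E).
suff : (mul E <= W)%MS by move/mxrankS/leq_trans; apply; exact: rank_leq_row.
apply/row_subP => a; rewrite row_mult_mx; set f := 'X_[b a].
have [c [g /kill gE Ig]] := eP f.
have -> : NF (f * E) = \sum_i c i *: NF (e i * E).
  apply/eqP; rewrite -subr_eq0; apply/eqP.
  have -> : NF (f * E) - \sum_i c i *: NF (e i * E)
          = NF (f * E - \sum_i c i *: (e i * E)).
    rewrite [RHS]raddfB [in RHS]raddf_sum /=.
    by under [in RHS]eq_bigr do rewrite linearZ.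
  have -> : f * E - \sum_i c i *: (e i * E)
          = (f - \sum_i c i *: e i - g) * E + g * E.
    rewrite -mulrDl subrK mulrBl mulr_suml; congr (_ - _).
    by apply: eq_bigr => i _; rewrite scalerAl.
  by apply: (NF_ideal NFP); apply: in_idealD => //; apply: in_idealMr.
apply: summx_sub => i _; apply: scalemx_sub.
rewrite -(rowK (fun i => NF (e i * E))); exact: row_sub.
Qed.
End LocalDimension.

(** * Deformation by pure powers *)

Section Specialization.
Variables (K : fieldType) (n : nat) (G : 'I_n -> {mpoly {poly K}[n]}).
Variables (q : nat) (b : 'I_q -> 'X_{1..n}).
Variable NF : {linear {mpoly {poly K}[n]} -> 'rV[{poly K}]_q}.
Hypothesis NFP : is_normal_form G b NF.
Variable s : K.
Local Notation lift := (map_mpoly (@polyC K)).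
Local Notation ev := (horner_eval s).

Definition specialize_nf (f : {mpoly K[n]}) : 'rV[K]_q := map_mx ev (NF (lift f)).

Lemma specialize_nf_linear : linear specialize_nf.
Proof.
move=> c f g; rewrite /specialize_nf raddfD /= map_mpolyZ linearP /=.
rewrite map_mxD; congr (_ + _); apply/rowP => j.
by rewrite !mxE /= /horner_eval hornerM hornerC.
Qed.
HB.instance Definition _ :=
  GRing.isLinear.Build K {mpoly K[n]} 'rV[K]_q _ specialize_nf specialize_nf_linear.

Lemma liftX (m : 'X_{1..n}) : lift 'X_[m] = 'X_[m].
Proof. exact: map_mpolyX. Qed.

Lemma evX (m : 'X_{1..n}) : map_mpoly ev 'X_[m] = 'X_[m].
Proof. exact: map_mpolyX. Qed.

Lemma liftK (f : {mpoly K[n]}) : map_mpoly ev (lift f) = f.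
Proof. by apply/mpolyP => m; rewrite !mcoeff_map_mpoly /= /horner_eval hornerC. Qed.

Lemma specialize_nfE g : specialize_nf (map_mpoly ev g) = map_mx ev (NF g).
Proof.
elim/mpolyind: g => [|c m g _ _ IHg]; first by rewrite !raddf0.
rewrite !raddfD /= -IHg; congr (_ + _).
rewrite map_mpolyZ evX linearZ /= /specialize_nf liftX linearZ /=.
by apply/rowP => j; rewrite !mxE /= /horner_eval hornerM.
Qed.

Lemma specialize_normal_form :
  is_normal_form (fun k => map_mpoly ev (G k)) b specialize_nf.
Proof.
case: NFP => NFG NFr NFb; split=> [f k|f|j].
- by rewrite /= -[f in LHS]liftK -rmorphM specialize_nfE NFG raddf0.
- have [u Ef] := NFr (lift f); exists (fun k => map_mpoly ev (u k)).
  rewrite -[f in LHS]liftK [in LHS]Ef rmorphD !rmorph_sum /=; congr (_ + _).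
    by apply: eq_bigr => j _; rewrite map_mpolyZ evX mxE.
  by apply: eq_bigr => k _; rewrite rmorphM.
by rewrite -(evX (b j)) [LHS]specialize_nfE NFb map_delta_mx.
Qed.

Lemma trace_specialize f :
  \tr (mult_mx b specialize_nf f) = (\tr (mult_mx b NF (lift f))).[s].
Proof.
rewrite /mxtrace horner_sum; apply: eq_bigr => i _.
by rewrite /mult_mx !mxE rmorphM /= liftX.
Qed.

End Specialization.

Section Family.
Variables (K : fieldType) (n : nat) (F : 'I_n -> {mpoly K[n]}) (M D : nat).
Hypothesis lt_DM : (D < M)%N.
Hypothesis sizeF : forall k, (msize (F k) <= M)%N.

(** The last term dominates at infinity and keeps the total number of zeros
    constant; the middle one, for [s != 0], bounds the multiplicity at the
    origin. *)
Definition deformation s k : {mpoly K[n]} := F k + s *: 'X_k ^+ D + 'X_k ^+ M.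

(** One normal form over the polynomial ring in the parameter specialises to
    all members of the family, which is why the traces below are polynomials
    in the parameter. *)
Lemma normal_form_family : exists q (b : 'I_q -> 'X_{1..n})
    (NF : K -> {linear {mpoly K[n]} -> 'rV[K]_q}),
  (forall s, is_normal_form (deformation s) b (NF s)) /\
  forall f, exists t : {poly K}, forall s, \tr (mult_mx b (NF s) f) = t.[s].
Proof.
pose lift := map_mpoly (n := n) (@polyC K).
pose G k : {mpoly {poly K}[n]} :=
  lift (F k) + 'X *: 'X_k ^+ D + 'X_k ^+ M.
have size_lift f : (msize (lift f) <= msize f)%N.
  rewrite msizeE; apply/bigmax_leqP_seq => m; rewrite mcoeff_msupp.
  rewrite mcoeff_map_mpoly polyC_eq0 -mcoeff_msupp => /msize_mdeg_lt.
  by [].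
have leadsG k : leads (G k) (U_(k) *+ M)%MM.
  rewrite /leads -mpolyXn addrK mdegMn mdeg1 mul1n.
  apply: leq_trans (msizeD_le _ _) _; rewrite geq_max.
  rewrite (leq_trans (size_lift _) (sizeF k)) (leq_trans (msizeZ_le _ _)) //.
  by rewrite mpolyXn msizeX mdegMn mdeg1 mul1n.
have [|q [b [NF NFP]]] := normal_form_exists _ leadsG.
  exact: leq_ltn_trans lt_DM.
exists q, b, (fun s => specialize_nf NF s); split=> [s|f].
  have := specialize_normal_form NFP s.
  rewrite [X in is_normal_form X _ _](_ : _ = deformation s) //.
  apply/funext => k; rewrite /G /deformation !rmorphD /= liftK.
  by rewrite map_mpolyZ !rmorphXn /= !evX /horner_eval hornerX.
by exists (\tr (mult_mx b NF (lift f))) => s; rewrite trace_specialize.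
Qed.

End Family.

Section Codimension.
Variables (n : nat) (A : comNzRingType).
Implicit Types (J : {mpoly A[n]} -> Prop) (d : nat).

Lemma codim_le_sub J J' d : (forall f, J f -> J' f) -> codim_le J d -> codim_le J' d.
Proof. by move=> sub [e eP]; exists e => f; have [c /sub] := eP f; exists c. Qed.

Lemma codim_le_card (T : finType) (B : pred T) (v : T -> {mpoly A[n]}) J d :
  (#|B| <= d)%N ->
  (forall f, exists y : T -> A, J (f - \sum_(x in B) y x *: v x)) -> codim_le J d.
Proof.
move=> le_Bd vP; pose x (i : 'I_d) := nth None [seq Some x | x <- enum B] i.
exists (fun i => if x i is Some x then v x else 0) => f; have [y Jy] := vP f.
exists (fun i => if x i is Some x then y x else 0).
rewrite (_ : \sum_i _ = \sum_(x in B) y x *: v x) //.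
pose h o := if o is Some x then y x *: v x else 0.
transitivity (\sum_(i < d) h (x i)).
  by apply: eq_bigr => i _; rewrite /h; case: (x i); rewrite ?scale0r.
rewrite -(big_mkord xpredT (fun i => h (nth None [seq Some x | x <- enum B] i))).
have sz : size [seq Some x | x <- enum B] = #|B| by rewrite size_map -cardE.
have tail : \sum_(#|B| <= i < d) h (nth None [seq Some x | x <- enum B] i) = 0.
  rewrite big_nat_cond big1 // => i /andP[/andP[le_Bi _] _].
  by rewrite nth_default ?sz.
rewrite (big_cat_nat (leq0n _) le_Bd) /= tail addr0.
by rewrite -sz -(big_nth None xpredT h) big_map -big_enum.
Qed.

Lemma codim_le_leq J d d' : (d <= d')%N -> codim_le J d -> codim_le J d'.
Proof.
move=> le_dd [e eP]; apply: (@codim_le_card _ predT e) => //.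
by rewrite card_ord.
Qed.

End Codimension.

Lemma avoid_roots (K : numFieldType) (g : {poly K}) j0 : g != 0 ->
  exists2 j : nat, (j0 <= j)%N & g.[j%:R] != 0.
Proof.
move=> g0; apply: contrapT => nex.
pose rs := [seq (j%:R : K) | j <- iota j0 (size g)].
have : (size rs < size g)%N.
  apply: max_poly_roots => //; last first.
    by rewrite map_inj_uniq ?iota_uniq //; apply: mulrIn; exact: oner_neq0.
  apply/allP => _ /mapP[j + ->]; rewrite mem_iota => /andP[le_j _].
  by apply/rootP/eqP/negPn/negP => gj; apply: nex; exists j.
by rewrite size_map size_iota ltnn.
Qed.

Section GenericMember.
Variables (K : numFieldType) (n : nat) (F : 'I_n -> {mpoly K[n]}) (M D : nat).
Hypothesis D_gt0 : (0 < D)%N.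

(** At infinite parameter the family degenerates to the powers [X_k ^ D], and
    the monomials with exponents below [D] span the quotient.  Modulo a power
    of the maximal ideal spanning is an open condition, expressed by a
    determinant that is a polynomial in the inverse of the parameter. *)
Lemma codim_deformation N j0 : exists2 j : nat, (j0 <= j)%N &
  codim_le (thickened (deformation F M D j%:R^-1) N) (D ^ n).
Proof.
pose T : finType := 'X_{1..n < N}.
(* A multiple of [X_k ^ D] is perturbed to the same multiple of an equation
   divided by the parameter; other monomials are kept. [H] holds the
   coefficients of the perturbation. *)
pose high (a : T) := [pick k : 'I_n | (D <= a k)%N].
pose h (a : T) : {mpoly K[n]} :=
  if high a is Some k then 'X_[a - U_(k) *+ D] * (F k + 'X_k ^+ M) else 0.
pose t (i : 'I_#|T|) : T := enum_val i.
pose H : 'M[{poly K}]_#|T| := \matrix_(i, j) ((h (t i))@_(t j))%:P.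
pose g := \det (1%:M + 'X *: H).
have ev_g s : g.[s] = \det (\matrix_(i, j) ((i == j)%:R + s * (h (t i))@_(t j))).
  rewrite /g -[_.[s]]/(horner_eval s _) -det_map_mx; congr (\det _).
  apply/matrixP => i j; rewrite !mxE /=.
  rewrite /horner_eval. by rewrite hornerD hornerM hornerX hornerC hornerMn hornerC.
have g_neq0 : g != 0.
  apply/eqP => g0; have := ev_g 0; rewrite g0 horner0 => /esym/eqP.
  rewrite (_ : \matrix_(i, j) _ = 1%:M) ?det1 ?oner_eq0 //.
  by apply/matrixP => i j; rewrite !mxE mul0r addr0.
have [j lej gj] := avoid_roots (maxn j0 1) g_neq0.
exists j; first by apply: leq_trans lej; exact: leq_maxl.
have j_neq0 : j%:R != 0 :> K.
  by rewrite pnatr_eq0 -lt0n; apply: leq_trans lej; exact: leq_maxr.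
set sg : K := j%:R in gj j_neq0 *; set G := deformation F M D sg^-1.
pose v (a : T) : {mpoly K[n]} := 'X_[a] + sg *: h a.
have v_ideal a : high a != None -> in_ideal G (v a).
  rewrite /v /h /high; case: pickP => // k le_Da _.
  have -> : 'X_[a] = 'X_[a - U_(k) *+ D] * 'X_k ^+ D :> {mpoly K[n]}.
    rewrite mpolyXn -mpolyXD submK //; apply/mnm_lepP => i.
    by rewrite mulmnE mnm1E; case: eqP => [<-|_]; rewrite ?mul1n ?mul0n.
  rewrite scalerAr -mulrDr; apply: in_idealMl.
  have -> : 'X_k ^+ D + sg *: (F k + 'X_k ^+ M) = sg *: G k.
    rewrite /G /deformation !scalerDr scalerA divff // scale1r addrA.
    by congr (_ + _); rewrite addrC.
  by apply: in_idealZ; exact: in_ideal_gen.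
apply: (@codim_le_card _ _ T [pred a | high a == None] (fun a => 'X_[a])).
  (* A monomial is kept when all its exponents are below [D]; there are at
     most [D ^ n] of these. *)
  pose toD (a : T) : {ffun 'I_n -> 'I_D} := [ffun i => insubd (Ordinal D_gt0) (a i)].
  rewrite -[X in (_ <= X ^ _)%N]card_ord -[X in (_ <= _ ^ X)%N]card_ord -card_ffun.
  rewrite -(@card_in_imset _ _ toD); first exact: max_card.
  have low a : high a = None -> forall i, (a i < D)%N.
    by rewrite /high; case: pickP => // nolarge _ i; rewrite ltnNge nolarge.
  move=> a1 a2; rewrite !inE => /eqP/low low1 /eqP/low low2 /ffunP eq12.
  apply/val_inj/mnmP => i /=; have /(congr1 val) := eq12 i.
  by rewrite !ffunE !val_insubd low1 low2.
move=> f.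
pose B := \matrix_(i, j) ((i == j)%:R + sg * (h (t i))@_(t j)).
have B_unit : B \in unitmx by rewrite unitmxE unitfE -ev_g.
pose y := (\row_j f@_(t j)) *m invmx B.
exists (fun a => y 0 (enum_rank a)).
exists (f - \sum_(a : T) y 0 (enum_rank a) *: v a).
  move=> m lt_mN; rewrite mcoeffB raddf_sum /=.
  have <- : val (t (enum_rank (BMultinom lt_mN : T))) = m by rewrite /t enum_rankK.
  set jm := enum_rank _.
  have : (y *m B) 0 jm = f@_(t jm) by rewrite mulmxKV // mxE.
  rewrite mxE => <-; rewrite (reindex t) /=; last first.
    by apply: onW_bij; exact: enum_val_bij.
  apply/eqP; rewrite subr_eq0; apply/eqP/eq_bigr => i _.
  rewrite mcoeffZ /v mcoeffD mcoeffZ mcoeffX !mxE /t enum_valK; congr (_ * (_ + _)).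
  by rewrite -(inj_eq enum_val_inj) -(inj_eq val_inj).
have -> : \sum_a y 0 (enum_rank a) *: v a
    = \sum_(a in [pred a | high a == None]) y 0 (enum_rank a) *: 'X_[a]
    + \sum_(a | high a != None) y 0 (enum_rank a) *: v a.
  rewrite (bigID [pred a | high a == None]) /=; congr (_ + _).
  by apply: eq_bigr => a /eqP ha; rewrite /v /h ha scaler0 addr0.
set S1 := \sum_(a in _) _; set S2 := \sum_(a | _) _.
rewrite (_ : f - S1 - (f - (S1 + S2)) = S2) /S2; last by ring.
rewrite big_mkcond; apply: in_ideal_sum => a; case: ifP => [ha|_].
  by apply: in_idealZ; exact: v_ideal.
exact: in_ideal0.
Qed.
End GenericMember.

(** * Orders on the coordinate axes *)

Lemma coefXM_deriv (K : nzRingType) (g : {poly K}) k :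
  ('X * g^`())`_k = g`_k * k%:R.
Proof.
by rewrite coefXM coef_deriv; case: k => [|k]; rewrite ?mulr0 //= mulr_natr.
Qed.

(** The operator [X d/dX - a] removes the monomial of exponent [a] and lowers
    the order of vanishing at [1] by one. *)
Lemma fewnomial_eq0 (K : numFieldType) (S : seq nat) (g : {poly K}) :
  (forall k, k \notin S -> g`_k = 0) -> ('X - 1) ^+ (size S) %| g -> g = 0.
Proof.
elim: S g => [|a S IHS] g suppg.
  by move=> _; apply/polyP => k; rewrite suppg ?coef0.
move=> /= div_g.
have : 'X * g^`() - a%:R *: g = 0.
  apply: IHS => [k Sk|].
    rewrite coefB coefXM_deriv coefZ mulrC -mulrBl.
    have [->|ne_ka] := eqVneq k a; first by rewrite subrr mul0r.
    by rewrite suppg ?mulr0 // in_cons negb_or ne_ka.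
  have /dvdpP[h ->] := div_g; apply/dvdpP.
  exists (('X - 1) * ('X * h^`()) + (size S).+1%:R *: ('X * h)
          - a%:R *: (('X - 1) * h)).
  rewrite derivM deriv_exp derivB derivX derivC subr0 /= exprS.
  by rewrite -!mul_polyC; ring.
move=> Eg; have g_mono k : k != a -> g`_k = 0.
  move=> ne_ka; have := congr1 (coefp k) Eg; rewrite /= coefB coefXM_deriv coefZ coef0.
  move/eqP; rewrite mulrC -mulrBl mulf_eq0 subr_eq0 eqr_nat (negPf ne_ka) /=.
  by move/eqP.
have g1 : g.[1] = 0.
  by have /dvdpP[h ->] := div_g; rewrite exprS !hornerM hornerXsubC subrr mul0r mulr0.
have ga : g`_a = g.[1].
  have [lt_a|le_a] := ltnP a (size g); last first.
    rewrite g1 nth_default //.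
  rewrite horner_coef (bigD1 (Ordinal lt_a)) //= expr1n mulr1 big1 ?addr0 // => k.
  by rewrite -val_eqE /= => ne_ka; rewrite g_mono ?mul0r.
apply/polyP => k; rewrite coef0; have [->|/g_mono//] := eqVneq k a.
by rewrite ga.
Qed.

Section Axes.
Variables (R : realType) (n : nat).
Implicit Types (G : {mpoly R[i][n]}) (i : 'I_n).

(** Restriction to the [i]-th coordinate axis. *)
Definition on_axis i : {mpoly R[i][n]} -> {poly R[i]} :=
  mmap (@polyC R[i]) (fun j => if j == i then 'X else 0).

Lemma on_axisX i m : on_axis i 'X_[m] = ((m == U_(i) *+ m i)%MM)%:R * 'X^(m i).
Proof.
rewrite /on_axis mmapX /mmap1 (bigD1 i) //= eqxx.
have [Em|ne_m] := eqVneq m (U_(i) *+ m i)%MM.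
  rewrite mul1r big1 ?mulr1 // => j ne_ji.
  by rewrite {1}Em mulmnE mnm1E [i == j]eq_sym (negPf ne_ji) mul0n expr0.
have [j ne_ji mj] : exists2 j, j != i & m j != 0%N.
  apply: contrapT => nex; move/eqP: ne_m; apply; apply/mnmP => j.
  rewrite mulmnE mnm1E; have [->|ne_ij] := eqVneq; first by rewrite mul1n.
  apply/eqP; rewrite mul0n; apply: contraT => mj; case: nex.
  by exists j => //; rewrite eq_sym.
by rewrite (bigD1 j) //= (negPf ne_ji) expr0n (negPf mj) mul0r mulr0 mul0r.
Qed.

Lemma coef_on_axis i G d : (on_axis i G)`_d = G@_(U_(i) *+ d).
Proof.
rewrite [G]mpolyE /on_axis !raddf_sum coef_sum; apply: eq_bigr => m _ /=.
rewrite mmapZ -/(on_axis i _) on_axisX coefCM mcoeffZ mcoeffX; congr (_ * _).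
rewrite -polyC_natr coefCM coefXn -natrM mulnb; congr (_%:R); congr nat_of_bool.
apply/andP/eqP => [[/eqP Em /eqP->]|->]; first by rewrite -Em.
by split; rewrite mulmnE mnm1E eqxx mul1n.
Qed.

(** A convex combination of vectors with nonnegative entries lies on an axis
    only if the vectors of nonzero weight do. *)
Lemma convenient_axis G i : convenient G -> exists d, (U_(i) *+ d)%MM \in msupp G.
Proof.
move=> /(_ i)[_ [[k [w [s [sG w0 w1 ->]]]] axis]].
have [l wl] : exists l, w l != 0.
  apply: contrapT => nex; move/eqP: w1; rewrite big1 => [|l _].
    by rewrite eq_sym oner_eq0.
  by apply/eqP; apply: contraT => wl; case: nex; exists l.
have [a Ga Ea] := sG l; exists (a i).
suff <- : a = (U_(i) *+ a i)%MM by [].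
apply/mnmP => j; rewrite mulmnE mnm1E.
have [->|ne_ij] := eqVneq; first by rewrite mul1n.
rewrite mul0n; have := axis j; rewrite eq_sym => /(_ ne_ij)/eqP.
rewrite summxE psumr_eq0 => [/allP/(_ l)|l' _]; last first.
  have [a' _ <-] := sG l'.
  by rewrite !mxE mulr_ge0 ?ler0n.
rewrite mem_index_enum => /(_ isT) /=.
by rewrite -Ea !mxE mulf_eq0 (negPf wl) pnatr_eq0 => /eqP.
Qed.

(** On a coordinate axis the system consists of polynomials in [x + 1] with
    [N + 1] terms, which cannot vanish to order [N + 1] at the origin. *)
Lemma axis_order (N : nat) (C : 'M[R[i]]_(n, N.+1)) (A : 'M[nat]_(n.+1, N.+1)) k i :
  convenient (shifted_system C A k) ->
  exists2 d, (d <= N)%N & (U_(i) *+ d)%MM \in msupp (shifted_system C A k).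
Proof.
set G := shifted_system C A k => /(convenient_axis i)[d0 Gd0].
apply: contrapT => nlow; pose a j := A (lift ord0 i) j.
have GE : on_axis i G = \sum_j C k j *: ('X + 1) ^+ a j.
  rewrite /G /shifted_system /on_axis raddf_sum; apply: eq_bigr => j _ /=.
  rewrite mmapZ mul_polyC rmorph_prod (bigD1 i) //=; congr (_ *: _).
  rewrite rmorphXn rmorphD rmorph1 /= mmapX mmap1U eqxx big1 ?mulr1 // => l ne_li.
  by rewrite rmorphXn rmorphD rmorph1 /= mmapX mmap1U (negPf ne_li) add0r expr1n.
pose g := on_axis i G \Po ('X - 1).
have gE : g = \sum_j C k j *: 'X^(a j).
  rewrite /g GE raddf_sum; apply: eq_bigr => j _ /=.
  by rewrite linearZ /= rmorphXn rmorphD rmorph1 /= comp_polyX subrK.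
have g0 : g = 0.
  apply: (@fewnomial_eq0 _ [seq a j | j <- enum 'I_N.+1]).
    move=> l Sl; rewrite gE coef_sum big1 // => j _.
    rewrite coefZ coefXn; case: eqP => [El|_]; last by rewrite mulr0.
    by case/negP: Sl; rewrite El map_f ?mem_enum.
  rewrite size_map size_enum_ord /g.
  have -> : on_axis i G = drop_poly N.+1 (on_axis i G) * 'X^(N.+1).
    rewrite -{1}(poly_take_drop N.+1 (on_axis i G)) (_ : take_poly _ _ = 0) ?add0r //.
    apply/polyP => d; rewrite coef_take_poly coef0 coef_on_axis.
    case: ltnP => // lt_d; apply: memN_msupp_eq0; apply/negP => Gd.
    by apply: nlow; exists d.
  by rewrite comp_polyM rmorphXn /= comp_polyX dvdp_mull.
have f0 : on_axis i G = 0.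
  have : g \Po ('X + 1) = on_axis i G.
    by rewrite /g -comp_polyA comp_polyB comp_polyX comp_polyC addrK comp_polyXr.
  by rewrite g0 comp_poly0.
by move: Gd0; rewrite mcoeff_msupp -coef_on_axis f0 coef0 eqxx.
Qed.
End Axes.

(** * Limits along ultrafilters *)

Local Open Scope classical_set_scope.

Section Modulus.
Variable R : realType.
Implicit Types z : R[i].

(** The modulus as a real number; the norm of [R[i]] takes values in [R[i]]. *)
Definition modulus z : R := complex.Re `|z|.

Lemma modulusE z : `|z| = (modulus z)%:C%C.
Proof. by rewrite /modulus normc_def. Qed.

Lemma modulusM z1 z2 : modulus (z1 * z2) = modulus z1 * modulus z2.
Proof. by apply: (@complexI R); rewrite rmorphM /= -!modulusE normrM. Qed.

Lemma modulusV z : modulus z^-1 = (modulus z)^-1.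
Proof. by apply: (@complexI R); rewrite fmorphV /= -!modulusE normfV. Qed.

Lemma modulus1 : modulus 1 = 1.
Proof. by apply: (@complexI R); rewrite -modulusE normr1. Qed.

Lemma modulusX z k : modulus (z ^+ k) = modulus z ^+ k.
Proof. by elim: k => [|k IHk]; rewrite ?expr0 ?modulus1 // !exprS modulusM IHk. Qed.

Lemma modulus_prod (I : Type) (r : seq I) (z : I -> R[i]) :
  modulus (\prod_(i <- r) z i) = \prod_(i <- r) modulus (z i).
Proof. by apply: big_morph; [exact: modulusM | exact: modulus1]. Qed.

Lemma modulus_ge0 z : 0 <= modulus z.
Proof. by rewrite -lecR -modulusE; exact: normr_ge0. Qed.

Lemma modulus_gt0 z : (0 < modulus z) = (z != 0).
Proof. by rewrite -ltcR -modulusE; exact: normr_gt0. Qed.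

Lemma modulusR (x : R) : `|x%:C%C| = `|x|%:C%C.
Proof. by rewrite normc_def /= expr0n addr0 sqrtr_sqr. Qed.

Lemma modulus_real (x : R) : modulus x%:C%C = `|x|.
Proof. by rewrite /modulus modulusR. Qed.

Lemma modulus_le z : modulus z <= `|complex.Re z| + `|complex.Im z|.
Proof.
rewrite /modulus normc_def /= -[leRHS]ger0_norm ?addr_ge0 // -sqrtr_sqr.
rewrite ler_wsqrtr // sqrrD !real_normK ?num_real // -addrA lerD2l.
by rewrite lerDr mulrn_wge0 ?mulr_ge0.
Qed.

Lemma Re_le_modulus z : `|complex.Re z| <= modulus z.
Proof. by rewrite /modulus normc_def /= -sqrtr_sqr ler_wsqrtr // lerDl sqr_ge0. Qed.

Lemma Im_le_modulus z : `|complex.Im z| <= modulus z.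
Proof. by rewrite /modulus normc_def /= -sqrtr_sqr ler_wsqrtr // lerDr sqr_ge0. Qed.

Lemma modulusD z1 z2 : modulus (z1 + z2) <= modulus z1 + modulus z2.
Proof. by rewrite -lecR rmorphD /= -!modulusE; exact: ler_normD. Qed.

Lemma modulusN z : modulus (- z) = modulus z.
Proof. by rewrite /modulus normrN. Qed.

Lemma modulus_sum (I : Type) (r : seq I) (z : I -> R[i]) :
  modulus (\sum_(i <- r) z i) <= \sum_(i <- r) modulus (z i).
Proof.
elim: r => [|i r IHr]; first by rewrite !big_nil /modulus normr0.
by rewrite !big_cons (le_trans (modulusD _ _)) // lerD2l.
Qed.

Lemma pos_complexP (e : R[i]) : 0 < e -> exists2 x : R, 0 < x & e = x%:C%C.
Proof.
move=> e0; exists (modulus e); first by rewrite modulus_gt0 gt_eqF.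
by rewrite -modulusE gtr0_norm.
Qed.

End Modulus.

Section UltraLimits.
Variables (U : set_system nat).
Context {UU : UltraFilter U}.

(** Along an ultrafilter every bounded sequence converges and every finite
    alternative is decided, so one limit replaces the successive extraction
    of subsequences. *)
Definition tends (K : numFieldType) (u : nat -> K) (l : K) : Prop := u @ U --> l.

Lemma tendsP (K : numFieldType) (u : nat -> K) l :
  tends u l <-> forall e, 0 < e -> U [set j | `|u j - l| < e].
Proof.
rewrite /tends; split=> [/cvgrPdist_lt ul e /ul|ul].
  by apply: filterS => j /=; rewrite distrC.
by apply/cvgrPdist_lt => e /ul; apply: filterS => j /=; rewrite distrC.
Qed.

Section Field.
Variable K : numFieldType.
Implicit Types (u v : nat -> K) (a b l : K).

Lemma tends_cst a : tends (fun=> a) a.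
Proof. exact: cvg_cst. Qed.

Lemma tendsD u v a b : tends u a -> tends v b -> tends (fun j => u j + v j) (a + b).
Proof. by move=> ua vb; exact: cvgD. Qed.

Lemma tendsN u a : tends u a -> tends (fun j => - u j) (- a).
Proof. by move=> ua; exact: cvgN. Qed.

Lemma tendsM u v a b : tends u a -> tends v b -> tends (fun j => u j * v j) (a * b).
Proof. by move=> ua vb; exact: cvgM. Qed.

Lemma tends_exp u a k : tends u a -> tends (fun j => u j ^+ k) (a ^+ k).
Proof.
move=> ua; elim: k => [|k IHk]; first exact: tends_cst.
rewrite exprS; under [X in tends X]eq_fun do rewrite exprS.
exact: tendsM.
Qed.

Lemma tends_sum (I : eqType) (r : seq I) (u : I -> nat -> K) (l : I -> K) :
  (forall i, i \in r -> tends (u i) (l i)) ->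
  tends (fun j => \sum_(i <- r) u i j) (\sum_(i <- r) l i).
Proof.
elim: r => [|i r IHr] ul.
  under [X in tends X]eq_fun do rewrite big_nil.
  by rewrite big_nil; exact: tends_cst.
under [X in tends X]eq_fun do rewrite big_cons.
rewrite big_cons; apply: tendsD; first by apply: ul; rewrite mem_head.
by apply: IHr => i' ri'; apply: ul; rewrite in_cons ri' orbT.
Qed.

Lemma tends_prod (I : Type) (r : seq I) (u : I -> nat -> K) (l : I -> K) :
  (forall i, tends (u i) (l i)) ->
  tends (fun j => \prod_(i <- r) u i j) (\prod_(i <- r) l i).
Proof.
move=> ul; elim: r => [|i r IHr].
  under [X in tends X]eq_fun do rewrite big_nil.
  by rewrite big_nil; exact: tends_cst.
under [X in tends X]eq_fun do rewrite big_cons.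
by rewrite big_cons; apply: tendsM.
Qed.

Lemma tends_meval n (f : {mpoly K[n]}) (p : nat -> 'I_n -> K) w :
  (forall i, tends (p^~ i) (w i)) -> tends (fun j => f.@[p j]) f.@[w].
Proof.
move=> pw; rewrite mevalE; under [X in tends X]eq_fun do rewrite mevalE.
apply: tends_sum => m _; apply: tendsM; first exact: tends_cst.
by apply: tends_prod => i; apply: tends_exp.
Qed.

Lemma tends_unique u a b : tends u a -> tends u b -> a = b.
Proof. exact: norm_cvg_unique. Qed.

Lemma tends_ae u v a : U [set j | u j = v j] -> tends u a -> tends v a.
Proof.
move=> uv /tendsP ua; apply/tendsP => e /ua.
by apply: filterS2 uv => j /= ->.
Qed.

End Field.
Lemma ultra_ex (A : set nat) : U A -> exists j, A j.
Proof. by move=> /filter_ex. Qed.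

Lemma ultra_finite_choice (T : eqType) (s : seq T) (P : T -> nat -> Prop) :
  (forall j, exists2 x, x \in s & P x j) -> exists2 x, x \in s & U [set j | P x j].
Proof.
move=> ex; apply: contrapT => nex.
have : U [set j | forall x, x \in s -> ~ P x j].
  elim: s nex {ex} => [|x s IHs] nex; first by apply: filterS filterT => j _ x.
  have [|UxN] := in_ultra_setVsetC [set j | P x j] UU.
    by move=> Ux; case: nex; exists x; rewrite ?mem_head.
  have /IHs : ~ (exists2 x, x \in s & U [set j | P x j]).
    by move=> [y sy Uy]; apply: nex; exists y; rewrite // in_cons sy orbT.
  apply: filterS2 UxN => j /= Nx Ns y; rewrite in_cons => /predU1P[->//|].
  exact: Ns.
by move=> /ultra_ex[j Nj]; have [x sx /(Nj x sx)] := ex j.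
Qed.

Lemma ultra_all (T : eqType) (s : seq T) (P : T -> nat -> Prop) :
  (forall x, x \in s -> U [set j | P x j]) ->
  U [set j | forall x, x \in s -> P x j].
Proof.
elim: s => [|x s IHs] sP; first by apply: filterS filterT => j _ x.
have {}IHs : U [set j | forall x, x \in s -> P x j].
  by apply: IHs => y sy; apply: sP; rewrite in_cons sy orbT.
have Ux : U [set j | P x j] by apply: sP; rewrite mem_head.
apply: filterS2 Ux IHs => j /= Px Ps y; rewrite in_cons => /predU1P[->//|].
exact: Ps.
Qed.

Lemma fmap_ultra (T : Type) (u : nat -> T) : UltraFilter (fmap u U).
Proof.
split=> [|G PG sub]; first exact: fmap_proper_filter.
apply/seteqP; split=> // A GA; have [|UA] := in_ultra_setVsetC (u @^-1` A) UU.
  by [].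
have : G (~` A) by apply: sub.
move=> /(filterI GA); rewrite setICr => /filter_not_empty; by case.
Qed.

Section Complex.
Variable R : realType.

Lemma real_bounded_tends (u : nat -> R) (B : R) :
  U [set j | `|u j| <= B] -> exists a : R, tends u a.
Proof.
move=> ub; have := @segment_compact R (- B) B.
rewrite compact_ultra => /(_ (u @ U)); case; first exact: fmap_ultra.
  by apply: (@filterS _ U _ _ _ _ ub) => j /=; rewrite in_itv /= -ler_norml.
by move=> a [_ ua]; exists a.
Qed.

Lemma tends_complexP (u : nat -> R[i]) (l : R[i]) :
  tends u l <-> forall e : R, 0 < e -> U [set j | modulus (u j - l) < e].
Proof.
rewrite tendsP; split=> ul e.
  rewrite -ltcR => /ul; apply: filterS => j /=.
  by rewrite modulusE ltcR.
move=> /pos_complexP[x x0 ->]; have := ul _ x0.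
by apply: filterS => j /=; rewrite modulusE ltcR.
Qed.

Lemma tends_modulus (u : nat -> R[i]) (l : R[i]) :
  tends u l -> tends (fun j => modulus (u j)) (modulus l).
Proof.
move=> /tends_complexP ul; apply/tendsP => e /ul; apply: filterS => j /=.
apply: le_lt_trans; rewrite -lecR -modulusR rmorphB /= -!modulusE.
exact: ler_dist_dist.
Qed.

Lemma complex_bounded_tends (u : nat -> R[i]) (B : R) :
  U [set j | modulus (u j) <= B] -> exists l : R[i], tends u l.
Proof.
move=> uB.
have [|a /tendsP ua] := @real_bounded_tends (fun j => complex.Re (u j)) B.
  by apply: filterS uB => j /=; apply: le_trans; exact: Re_le_modulus.
have [|b /tendsP ub] := @real_bounded_tends (fun j => complex.Im (u j)) B.
  by apply: filterS uB => j /=; apply: le_trans; exact: Im_le_modulus.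
exists (a +i* b)%C; apply/tends_complexP => e e0.
have e20 : 0 < e / 2 by rewrite divr_gt0.
apply: filterS2 (ua _ e20) (ub _ e20) => j /= ea eb.
apply: le_lt_trans (modulus_le _) _; rewrite [e]splitr.
by case: (u j) ea eb => x y /= ea eb; exact: ltrD.
Qed.

End Complex.
End UltraLimits.

(** * A Lojasiewicz inequality *)

Definition free_ultrafilter (U : set_system nat) : Prop :=
  UltraFilter U /\ forall N : nat, U [set j | (N <= j)%N].

Lemma free_ultrafilter_exists : exists U, free_ultrafilter U.
Proof.
have [U [UU sub]] := @ultraFilterLemma nat \oo _.
by exists U; split=> // N; apply: sub; exists N.
Qed.

Section Directions.
Variables (R : realType) (n : nat) (U : set_system nat).
Context {UU : UltraFilter U}.
Hypothesis freeU : forall N : nat, U [set j | (N <= j)%N].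
Implicit Types (a b : 'X_{1..n}) (L eta : nat -> 'I_n -> R).

Lemma ultra_inv_nat (e : R) : 0 < e -> U [set j | j.+1%:R^-1 < e].
Proof.
move=> e0; have [N ltN] : exists N : nat, e^-1 < N%:R.
  by exists (Num.truncn e^-1).+1; rewrite truncnS_gt.
apply: filterS (freeU N) => j /= leNj; rewrite invf_plt ?posrE //.
by apply: lt_le_trans ltN _; rewrite ler_nat leqW.
Qed.

Lemma weightB (eps1 eps2 : 'I_n -> R) a :
  weight (fun i => eps1 i - eps2 i) a = weight eps1 a - weight eps2 a.
Proof. by rewrite /weight -sumrB; apply: eq_bigr => i _; rewrite mulrBl. Qed.

Lemma tends_weight eta (eta0 : 'I_n -> R) a :
  (forall i, tends U (eta^~ i) (eta0 i)) ->
  tends U (fun j => weight (eta j) a) (weight eta0 a).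
Proof.
by move=> eta_lim; apply: tends_sum => i _; apply: tendsM => //; exact: tends_cst.
Qed.

(** The convergence of finitely many linear functionals along [L] is realised
    by a convergent sequence of vectors with the same values: a generalised
    inverse of the matrix of the functionals produces it. *)
Lemma convergent_lift L (S : seq ('X_{1..n} * 'X_{1..n})) :
  (forall ab, ab \in S -> exists l,
    tends U (fun j => weight (L j) ab.1 - weight (L j) ab.2) l) ->
  exists eta, exists eta0 : 'I_n -> R, (forall i, tends U (eta^~ i) (eta0 i)) /\
    forall j ab, ab \in S ->
      weight (eta j) ab.1 - weight (eta j) ab.2
    = weight (L j) ab.1 - weight (L j) ab.2.
Proof.
move=> Slim; pose ab r := nth (0%MM, 0%MM) S r.
pose B : 'M[R]_(size S, n) := \matrix_(r, i) (((ab r).1 i)%:R - ((ab r).2 i)%:R).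
have BE (eps : 'I_n -> R) r :
    (B *m \col_i eps i) r 0 = weight eps (ab r).1 - weight eps (ab r).2.
  rewrite mxE /weight -sumrB; apply: eq_bigr => i _.
  by rewrite !mxE mulrBl ![eps i * _]mulrC.
have /choice[l lP] (r : 'I_(size S)) :
    exists l, tends U (fun j => (B *m \col_i L j i) r 0) l.
  have [|l ll] := Slim (ab r); first by rewrite mem_nth.
  by exists l; apply: tends_ae ll; apply: filterS filterT => j _ /=; rewrite BE.
pose eta j i := (pinvmx B *m (B *m \col_i L j i)) i 0.
exists eta, (fun i => \sum_r pinvmx B i r * l r); split=> [i|j ab' Sab].
  apply: tends_ae (tends_sum _) => [|r _]; last first.
    by apply: tendsM; [exact: tends_cst | exact: lP].
  by apply: filterS filterT => j _ /=; rewrite /eta mxE.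
have lt_r : (index ab' S < size S)%N by rewrite index_mem.
have <- : ab (Ordinal lt_r) = ab' by rewrite /ab nth_index.
rewrite -!BE; congr (fun_of_matrix _ _ _).
have -> : \col_i eta j i = pinvmx B *m (B *m \col_i L j i).
  by apply/colP => i; rewrite mxE.
by rewrite (mulmxA B) (mulmxA _ B) mulmxKpV.
Qed.

End Directions.

Lemma seq_argmin (R : realDomainType) (T : eqType) (s : seq T) (w : T -> R) x0 :
  x0 \in s -> exists2 x, x \in s & forall y, y \in s -> w x <= w y.
Proof.
elim: s x0 => // x s IHs x0 _.
case: s IHs => [|x1 s] IHs.
  by exists x; rewrite ?mem_head // => y; rewrite inE => /eqP->.
have [y sy ymin] := IHs x1 (mem_head _ _).
have [le_xy|lt_yx] := leP (w x) (w y).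
  exists x; rewrite ?mem_head // => z; rewrite in_cons => /predU1P[->//|/ymin].
  exact: le_trans.
exists y => [|z]; first by rewrite in_cons sy orbT.
by rewrite in_cons => /predU1P[->|/ymin //]; exact: ltW.
Qed.

Section NoBadSequence.
Variables (R : realType) (n : nat) (F : 'I_n -> {mpoly R[i][n]}) (D : nat).
Hypothesis nondeg : forall eps : 'I_n -> R, (forall i, 0 < eps i) ->
  ~ exists2 x : 'I_n -> R[i], forall i, x i != 0 &
      forall k, (initial_form eps (F k)).@[x] = 0.
Hypothesis axes : forall k i, exists2 d, (d <= D)%N & (U_(i) *+ d)%MM \in msupp (F k).

Variable U : set_system nat.
Context {UU : UltraFilter U}.
Hypothesis freeU : forall N : nat, U [set j | (N <= j)%N].
Variable p : nat -> 'I_n -> R[i].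
Hypothesis p_neq0 : forall j i, p j i != 0.
Hypothesis p_small : forall j i, modulus (p j i) < j.+1%:R^-1.
Hypothesis F_small : forall j k, exists i,
  modulus (F k).@[p j] < j.+1%:R^-1 * modulus (p j i) ^+ D.

Let X (m : 'X_{1..n}) (v : 'I_n -> R[i]) : R[i] := \prod_i v i ^+ m i.
Let L j i : R := - ln (modulus (p j i)).

Let mod_gt0 j i : 0 < modulus (p j i).
Proof. by rewrite modulus_gt0. Qed.

Let X_neq0 m j : X m (p j) != 0.
Proof. by apply/prodf_neq0 => i _; rewrite expf_neq0. Qed.

Let modX m j : modulus (X m (p j)) = expR (- weight (L j) m).
Proof.
rewrite modulus_prod /weight -sumrN expR_sum; apply: eq_bigr => i _.
by rewrite modulusX /L mulNr opprK mulrC expRM_natl lnK ?posrE.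
Qed.

Let min_exponent k : exists a, a \in msupp (F k) /\
  U [set j | forall b, b \in msupp (F k) -> weight (L j) a <= weight (L j) b].
Proof.
have [|a aF amin] := @ultra_finite_choice U _ _ (msupp (F k)) (fun a j =>
  forall b, b \in msupp (F k) -> weight (L j) a <= weight (L j) b).
  move=> j; have [i _] := F_small j k; have [d _ dF] := axes k i.
  exact: seq_argmin dF.
by exists a.
Qed.

Let tends_bound (u : nat -> R) l : tends U u l -> U [set j | u j < l + 1].
Proof.
move=> /tendsP/(_ 1 ltr01); apply: filterS => j /= /ltr_normlW.
by rewrite ltrBlDl.
Qed.

Let tends_continuous (f : R -> R) (u : nat -> R) l :
  {for l, continuous f} -> tends U u l -> tends U (fun j => f (u j)) (f l).
Proof. by move=> fl ul; apply: continuous_cvg. Qed.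

Let L_infty i M : U [set j | M < L j i].
Proof.
apply: filterS (ultra_inv_nat freeU (expR_gt0 (- M))) => j /= lt_jM.
rewrite /L ltrNr -[X in _ < X]expRK ltr_ln ?posrE ?expR_gt0 //.
exact: lt_trans lt_jM.
Qed.

Let weight_axis (eps : 'I_n -> R) i d : weight eps (U_(i) *+ d)%MM = eps i * d%:R.
Proof.
rewrite /weight (bigD1 i) //= mulmnE mnm1E eqxx mul1n big1 ?addr0 // => l.
by rewrite eq_sym mulmnE mnm1E => /negPf->; rewrite mul0n mulr0.
Qed.

(** Let [al k] be the exponent of [F k] that has the least weight for the
    logarithms [L j] of the coordinates of [p j], for almost all [j]. The
    ratios of the other terms of [F k] to that one converge to [z]. The
    weight [eps j] is a bounded correction of [L j] under which the
    exponents with [z != 0] have exactly the weight of [al k]; those with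
    [z = 0] are strictly heavier since [L j] separates them without bound.
    The initial forms for [eps j] thus consist of the terms with [z != 0],
    and after rescaling by [eps j] the points [p j] converge to a zero of
    them in the torus. *)
Lemma no_bad_sequence : False.
Proof.
have /choice[al alP] := min_exponent.
pose rho k b j := X b (p j) / X (al k) (p j).
have mod_rho k b j : modulus (rho k b j) = expR (weight (L j) (al k) - weight (L j) b).
  by rewrite modulusM modulusV !modX -expRN -expRD opprK addrC.
have /choice[z zP] (kb : 'I_n * 'X_{1..n}) : exists z,
    kb.2 \in msupp (F kb.1) -> tends U (rho kb.1 kb.2) z.
  case: kb => k b /=; have [Fb|_] := boolP (b \in _); last by exists 0.
  have [|z zlim] := @complex_bounded_tends U _ R (rho k b) 1; last by exists z.
  apply: filterS (alP k).2 => j /= /(_ b Fb) le_ab.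
  by rewrite mod_rho -expR0 ler_expR subr_le0.
have {}zP k b : b \in msupp (F k) -> tends U (rho k b) (z (k, b)).
  exact: (zP (k, b)).
(* For some [i] the equation [F k] is at most [|p_i| ^ D / (j + 1)] at
   [p j], and its dominant term is at least [|p_i| ^ D] because [F k]
   contains a power of [x_i] of exponent at most [D]. *)
have z_sum k : \sum_(b <- msupp (F k)) (F k)@_b * z (k, b) = 0.
  apply: (@tends_unique U _ _ (fun j => (F k).@[p j] / X (al k) (p j))).
    have : tends U (fun j => \sum_(b <- msupp (F k)) (F k)@_b * rho k b j)
                   (\sum_(b <- msupp (F k)) (F k)@_b * z (k, b)).
      apply: tends_sum => b Fb.
      by apply: tendsM; [exact: tends_cst | exact: zP].
    apply: tends_ae.
    apply: filterS filterT => j _ /=.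
    by rewrite mevalE mulr_suml; apply: eq_bigr => b _; rewrite mulrA.
  apply/tends_complexP => e /(ultra_inv_nat freeU).
  apply: filterS2 (alP k).2 => j /= almin lt_je; rewrite subr0.
  apply: le_lt_trans lt_je; have [i Fi] := F_small j k.
  rewrite modulusM modulusV ler_pdivrMr ?modulus_gt0 //.
  apply: le_trans (ltW Fi) _; rewrite ler_wpM2l ?invr_ge0 ?ler0n //.
  have [d le_dD dF] := axes k i; rewrite modX.
  apply: le_trans (_ : modulus (p j i) ^+ d <= _).
    apply: ler_wiXn2l => //; rewrite ?modulus_ge0 //.
    apply: le_trans (ltW (p_small j i)) _.
    by rewrite invf_le1 ?ltr0n // ler1n.
  have -> : modulus (p j i) ^+ d = expR (- weight (L j) (U_(i) *+ d)%MM).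
    by rewrite weight_axis /L mulNr opprK mulrC expRM_natl lnK ?posrE.
  by rewrite ler_expR lerN2 almin.
(* The differences of these exponents have convergent values along [L]. *)
pose S := [seq (b, al k) | k <- enum 'I_n,
                           b <- [seq b <- msupp (F k) | z (k, b) != 0]].
have SP k b : b \in msupp (F k) -> z (k, b) != 0 -> (b, al k) \in S.
  move=> Fb zb; apply: allpairs_f_dep; first by rewrite mem_enum.
  by rewrite mem_filter zb.
have [|eta [eta0 [eta_lim eta_eq]]] := @convergent_lift R n U _ L S.
  move=> _ /allpairsPdep[k [b [_ Fb ->]]] /=.
  move: Fb; rewrite mem_filter => /andP[zb Fb].
  exists (- ln (modulus (z (k, b)))).
  have zb_gt0 : 0 < modulus (z (k, b)) by rewrite modulus_gt0.
  have : tends U (fun j => - ln (modulus (rho k b j))) (- ln (modulus (z (k, b)))).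
    apply: tendsN; apply: (tends_continuous (continuous_ln zb_gt0)).
    by apply: tends_modulus; exact: zP.
  by apply: tends_ae; apply: filterS filterT => j _ /=; rewrite mod_rho expRK opprB.
pose eps j i := L j i - eta j i.
have eps_eq j k b : b \in msupp (F k) -> z (k, b) != 0 ->
    weight (eps j) b = weight (eps j) (al k).
  move=> Fb zb; have /= := eta_eq j _ (SP k b Fb zb).
  by rewrite /eps !weightB; lra.
have eps_pos : U [set j | forall i, i \in enum 'I_n -> 0 < eps j i].
  apply: ultra_all => i _.
  apply: filterS2 (tends_bound (eta_lim i)) (L_infty i (eta0 i + 1)) => j /=.
  by rewrite subr_gt0; exact: lt_trans.
have eps_lt : U [set j | forall k, k \in enum 'I_n -> forall b, b \in msupp (F k) ->
    z (k, b) = 0 -> weight (eps j) (al k) < weight (eps j) b].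
  apply: (@ultra_all U _ _ _ (fun k j => forall b, b \in msupp (F k) ->
    z (k, b) = 0 -> weight (eps j) (al k) < weight (eps j) b)) => k _.
  apply: (@ultra_all U _ _ _ (fun b j => z (k, b) = 0 ->
    weight (eps j) (al k) < weight (eps j) b)) => b Fb.
  have [z0|/eqP nz] := eqVneq (z (k, b)) 0; last first.
    by apply: filterS filterT => j _ /= z0; case: nz.
  have /tends_bound : tends U (fun j => weight (eta j) b - weight (eta j) (al k))
      (weight eta0 b - weight eta0 (al k)).
    by apply: tendsD; [|apply: tendsN]; apply: tends_weight.
  set M := _ + 1 => etaM.
  have : tends U (fun j => modulus (rho k b j)) (modulus (z (k, b))).
    by apply: tends_modulus; exact: zP.
  rewrite z0.
  have -> : modulus 0 = 0 :> R by rewrite /modulus normr0.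
  move=> /tendsP/(_ _ (expR_gt0 (- M))); apply: filterS2 etaM => j /= etaM.
  rewrite subr0 mod_rho ger0_norm ?expR_ge0 // ltr_expR => lt_LM _.
  by rewrite /eps !weightB; lra.
have [j0 [/= eps0_pos eps0_lt]] := ultra_ex (filterI eps_pos eps_lt).
(* The rescaled points have the arguments of [p j] and the moduli
   [exp (- eta j)]. *)
pose wj j i := p j i * (expR (eps j i))%:C%C.
have wj_mod j i : modulus (wj j i) = expR (- eta j i).
  rewrite modulusM modulus_real ger0_norm ?expR_ge0 //.
  rewrite -[modulus _]lnK ?posrE // -expRD; congr expR.
  by rewrite /eps /L; ring.
have exp_lim i : tends U (fun j => modulus (wj j i)) (expR (- eta0 i)).
  have : tends U (fun j => expR (- eta j i)) (expR (- eta0 i)).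
    by apply: tends_continuous; [exact: continuous_expR | exact: tendsN].
  by apply: tends_ae; apply: filterS filterT => j _ /=; rewrite wj_mod.
have /choice[w w_lim] i : exists l, tends U (wj^~ i) l.
  apply: (@complex_bounded_tends U _ R _ (expR (- eta0 i) + 1)).
  by apply: filterS (tends_bound (exp_lim i)) => j /= /ltW.
have w_neq0 i : w i != 0.
  rewrite -modulus_gt0.
  have -> : modulus (w i) = expR (- eta0 i); last exact: expR_gt0.
  by apply: tends_unique (exp_lim i); exact: tends_modulus.
have X_lim b : tends U (fun j => X b (wj j)) (X b w).
  by apply: tends_prod => i; apply: tends_exp.
have X_wj b j : X b (wj j) = X b (p j) * (expR (weight (eps j) b))%:C%C.
  rewrite /X /weight expR_sum rmorph_prod -big_split; apply: eq_bigr => i _ /=.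
  rewrite /wj exprMn -rmorphXn /=; congr (_ * _%:C%C).
  by rewrite -expRM_natl mulrC.
have X_w k b : b \in msupp (F k) -> z (k, b) != 0 -> X b w = z (k, b) * X (al k) w.
  move=> Fb zb; apply: (tends_unique (X_lim b)).
  have : tends U (fun j => rho k b j * X (al k) (wj j)) (z (k, b) * X (al k) w).
    by apply: tendsM; [exact: zP | exact: X_lim].
  apply: tends_ae.
  apply: filterS filterT => j _ /=.
  by rewrite !X_wj (eps_eq j k b Fb zb) mulrA divfK.
case: (nondeg (eps := eps j0)).
  by move=> i; apply: eps0_pos; rewrite mem_enum.
exists w => // k; rewrite /initial_form raddf_sum /=.
transitivity (X (al k) w * \sum_(b <- msupp (F k)) (F k)@_b * z (k, b)); last first.
  by rewrite z_sum mulr0.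
rewrite mulr_sumr big_mkcond; apply: eq_big_seq => b Fb /=.
have le_al c : c \in msupp (F k) -> weight (eps j0) (al k) <= weight (eps j0) c.
  move=> Fc; have [zc|zc] := eqVneq (z (k, c)) 0.
    by apply/ltW/eps0_lt; rewrite ?mem_enum.
  by rewrite (eps_eq j0 k c).
have [zb|zb] := eqVneq (z (k, b)) 0.
  rewrite zb !mulr0; case: allP => // /(_ _ (alP k).1).
  by rewrite leNgt eps0_lt ?mem_enum.
case: allP => [_|[]]; last first.
  by move=> c Fc; rewrite (eps_eq j0 k b Fb zb) le_al.
by rewrite mevalZ mevalX -/(X b w) (X_w k b Fb zb); ring.
Qed.
End NoBadSequence.

Section Lojasiewicz.
Variables (R : realType) (n : nat) (F : 'I_n -> {mpoly R[i][n]}) (D : nat).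
Hypothesis nondeg : forall eps : 'I_n -> R, (forall i, 0 < eps i) ->
  ~ exists2 x : 'I_n -> R[i], forall i, x i != 0 &
      forall k, (initial_form eps (F k)).@[x] = 0.
Hypothesis axes : forall k i, exists2 d, (d <= D)%N & (U_(i) *+ d)%MM \in msupp (F k).

Lemma lojasiewicz_torus : exists2 c : R, 0 < c &
  forall p : 'I_n -> R[i], (forall i, p i != 0) -> (forall i, modulus (p i) < c) ->
    exists k, forall i, c * modulus (p i) ^+ D <= modulus (F k).@[p].
Proof.
apply: contrapT => nex.
have /choice[p pP] (j : nat) : exists p : 'I_n -> R[i],
    [/\ forall i, p i != 0, forall i, modulus (p i) < j.+1%:R^-1
      & forall k, exists i,
          modulus (F k).@[p] < j.+1%:R^-1 * modulus (p i) ^+ D].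
  apply: contrapT => nexp; apply: nex; exists j.+1%:R^-1; first by rewrite invr_gt0.
  move=> p p0 pc; apply: contrapT => nk; apply: nexp; exists p; split=> // k.
  apply: contrapT => ni; apply: nk; exists k => i; rewrite leNgt; apply/negP => lti.
  by apply: ni; exists i.
have [U [UU freeU]] := free_ultrafilter_exists.
by apply: (no_bad_sequence nondeg axes freeU (p := p)) => j; case: (pP j).
Qed.

(** The torus is dense, and the failure of the bound at a point is an open
    condition. *)
Lemma lojasiewicz : exists2 c : R, 0 < c &
  forall p : 'I_n -> R[i], (forall i, modulus (p i) < c) ->
    exists k, forall i, c * modulus (p i) ^+ D <= modulus (F k).@[p].
Proof.
have [c c0 cP] := lojasiewicz_torus; exists c => // p pc.
apply: contrapT => nk.
have [U [UU freeU]] := free_ultrafilter_exists.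
pose q j i : R[i] := p i + (j.+1%:R^-1)%:C%C.
have q_lim i : tends U (q^~ i) (p i).
  rewrite -[X in tends U _ X]addr0; apply: tendsD; first exact: tends_cst.
  apply/tends_complexP => e /(ultra_inv_nat freeU).
  by apply: filterS => j /=; rewrite subr0 modulus_real ger0_norm ?invr_ge0 ?ler0n.
have near i (x : R) : modulus (p i) < x -> U [set j | modulus (q j i) < x].
  rewrite -subr_gt0 => lt_x.
  have /tendsP/(_ _ lt_x) : tends U (fun j => modulus (q j i)) (modulus (p i)).
    exact: tends_modulus.
  by apply: filterS => j /= /ltr_normlW; rewrite ltrD2r.
have q_small : U [set j | forall i, i \in enum 'I_n -> modulus (q j i) < c].
  by apply: ultra_all => i _; apply: near.
have q_neq0 : U [set j | forall i, i \in enum 'I_n -> q j i != 0].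
  apply: ultra_all => i _; have [p0|pi] := eqVneq (p i) 0.
    apply: filterS filterT => j _ /=; rewrite /q p0 add0r -modulus_gt0.
    by rewrite modulus_real gtr0_norm invr_gt0 ltr0n.
  have /tends_complexP/(_ (modulus (p i))) := q_lim i.
  rewrite modulus_gt0 => /(_ pi); apply: filterS => j /=.
  apply: contraTneq => ->; rewrite sub0r -leNgt.
  by rewrite /modulus normrN.
have q_bad k : exists i, U [set j | modulus (F k).@[q j] < c * modulus (q j i) ^+ D].
  have [i lti] : exists i, modulus (F k).@[p] < c * modulus (p i) ^+ D.
    apply: contrapT => ni; apply: nk; exists k => i; rewrite leNgt; apply/negP => lti.
    by apply: ni; exists i.
  exists i; have := lti; rewrite -subr_gt0 => lt0.
  have : tends U (fun j => c * modulus (q j i) ^+ D - modulus (F k).@[q j])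
                 (c * modulus (p i) ^+ D - modulus (F k).@[p]).
    apply: tendsD.
      apply: tendsM; first exact: tends_cst.
      by apply: tends_exp; apply: tends_modulus.
    by apply: tendsN; apply: tends_modulus; apply: tends_meval.
  move=> /tendsP/(_ _ lt0); apply: filterS => j /=.
  by rewrite distrC => /ltr_normlW; rewrite gtrDl oppr_lt0 subr_gt0.
have {}q_bad : U [set j | forall k, k \in enum 'I_n ->
    exists i, modulus (F k).@[q j] < c * modulus (q j i) ^+ D].
  apply: (@ultra_all U _ _ _ (fun k j =>
    exists i, modulus (F k).@[q j] < c * modulus (q j i) ^+ D)) => k _.
  by have [i iP] := q_bad k; apply: filterS iP => j ltj; exists i.
have [j [[/= j_small j_neq0] j_bad]] := ultra_ex (filterI (filterI q_small q_neq0) q_bad).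
have [||k kP] := cP (q j).
- by move=> i; apply: j_neq0; rewrite mem_enum.
- by move=> i; apply: j_small; rewrite mem_enum.
have [|i] := j_bad k; first by rewrite mem_enum.
by rewrite ltNge kP.
Qed.

End Lojasiewicz.

(** * Zeros of the deformed system *)

Lemma in_ideal_eval (K : comNzRingType) n (G : 'I_n -> {mpoly K[n]}) f x :
  in_ideal G f -> (forall k, (G k).@[x] = 0) -> f.@[x] = 0.
Proof.
move=> [u ->] Gx; rewrite raddf_sum big1 // => k _ /=.
by rewrite mevalM Gx mulr0.
Qed.

Section Zeros.
Variables (R : realType) (n : nat) (F : 'I_n -> {mpoly R[i][n]}) (M D : nat).
Hypothesis lt_DM : (D < M)%N.
Hypothesis sizeF : forall k, (msize (F k) <= M)%N.
Local Notation G s := (deformation F M D s%:C%C).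

Lemma deformation_eval s k x :
  (G s k).@[x] = (F k).@[x] + s%:C%C * x k ^+ D + x k ^+ M.
Proof. by rewrite /deformation !mevalD mevalZ !rmorphXn /= mevalXU. Qed.

(** With [r] the largest modulus of a coordinate, a zero with [r > 1]
    satisfies [r ^ M <= S * r ^ (M - 1)]. *)
Lemma zeros_bounded : exists B : R, forall s x, 0 <= s <= 1 ->
  (forall k, (G s k).@[x] = 0) -> forall i, modulus (x i) <= B.
Proof.
pose S := 1 + \sum_k \sum_(m <- msupp (F k)) modulus (F k)@_m.
have S_ge1 : 1 <= S.
  by rewrite lerDl; do 2!apply: sumr_ge0 => ? _; exact: modulus_ge0.
exists S => s x /andP[s0 s1] Gx i.
have [k _ kmax] := @seq_argmin _ _ (enum 'I_n) (fun i => - modulus (x i)) i (mem_enum _ i).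
have {}kmax l : modulus (x l) <= modulus (x k).
  by rewrite -lerN2 kmax ?mem_enum.
apply: le_trans (kmax i) _; set r := modulus (x k).
have [/le_trans->//|r_gt1] := leP r 1.
have r_gt0 : 0 < r by apply: lt_trans r_gt1.
have M_gt0 : (0 < M)%N by apply: leq_ltn_trans lt_DM.
rewrite -(ler_pM2r (exprn_gt0 M.-1 r_gt0)) -exprS prednK //.
rewrite -modulusX -modulusN; have := Gx k; rewrite deformation_eval.
move=> /eqP; rewrite addr_eq0 => /eqP <-.
apply: le_trans (modulusD _ _) _; rewrite addrC mulrDl mul1r lerD //.
  rewrite modulusM modulus_real modulusX ger0_norm //.
  apply: le_trans (_ : 1 * r ^+ D <= _).
    by rewrite ler_wpM2r // exprn_ge0 ?modulus_ge0.
  by rewrite mul1r ler_weXn2l ?(ltW r_gt1) // -ltnS prednK.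
rewrite mevalE; apply: le_trans (modulus_sum _ _) _.
rewrite (bigD1 k) //= mulrDl -[leLHS]addr0 lerD //; last first.
  rewrite mulr_ge0 ?exprn_ge0 ?(ltW r_gt0) //.
  by do 2!apply: sumr_ge0 => ? _; exact: modulus_ge0.
rewrite mulr_suml big_seq [leRHS]big_seq ler_sum // => m Fm.
rewrite modulusM ler_wpM2l ?modulus_ge0 // modulus_prod.
apply: le_trans (_ : \prod_i r ^+ m i <= _).
  apply: ler_prod => l _; rewrite modulusX exprn_ge0 ?modulus_ge0 //=.
  by rewrite lerXn2r ?nnegrE ?modulus_ge0 ?(ltW r_gt0).
rewrite -expr_sum -mdegE ler_weXn2l ?(ltW r_gt1) //.
by rewrite -ltnS prednK // (leq_trans (msize_mdeg_lt Fm)).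
Qed.

Variable c : R.
Hypothesis c_gt0 : 0 < c.
Hypothesis D_gt0 : (0 < D)%N.
Hypothesis loja : forall p : 'I_n -> R[i], (forall i, modulus (p i) < c) ->
  exists k, forall i, c * modulus (p i) ^+ D <= modulus (F k).@[p].

(** A nonzero zero [x] of the deformed system near the origin would satisfy
    [F k = - x k ^ D (s + x k ^ (M - D))], too small for the lower bound. *)
Lemma no_small_zeros s x : 0 <= s < c / 2 ->
  (forall i, modulus (x i) < Num.min 1 (c / 2)) ->
  (forall k, (G s k).@[x] = 0) -> forall i, x i = 0.
Proof.
move=> /andP[s0 s_lt] x_lt Gx.
have x_ltc l : modulus (x l) < c.
  apply: lt_le_trans (x_lt l) _; rewrite ge_min; apply/orP; right.
  by rewrite ler_pdivrMr // ler_peMr ?(ltW c_gt0) // ler1n.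
have [k kP] := loja x_ltc.
have Fk : modulus (F k).@[x] = modulus (x k) ^+ D * modulus (s%:C%C + x k ^+ (M - D)).
  rewrite -modulusX -modulusM -modulusN; congr modulus.
  have := Gx k; rewrite deformation_eval -addrA => /eqP.
  rewrite addr_eq0 => /eqP ->; rewrite opprK mulrDr -exprD subnKC ?(ltnW lt_DM) //.
  by rewrite mulrC.
have xk0 : x k = 0.
  apply/eqP; apply: contraT => xk; have := kP k.
  rewrite Fk [leLHS]mulrC ler_pM2l ?exprn_gt0 ?modulus_gt0 // leNgt.
  suff -> : modulus (s%:C%C + x k ^+ (M - D)) < c by [].
  apply: le_lt_trans (modulusD _ _) _; rewrite modulus_real ger0_norm //.
  rewrite [ltRHS]splitr ltrD // modulusX.
  have := x_lt k; rewrite lt_min => /andP[x1 xc]; apply: le_lt_trans xc.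
  have dM : (0 < M - D)%N by rewrite subn_gt0.
  rewrite -(prednK dM) exprS.
  by rewrite ler_piMr ?modulus_ge0 // exprn_ile1 ?modulus_ge0 // ltW.
move=> i; have := kP i; rewrite Fk xk0 /modulus normr0 /= expr0n eqn0Ngt D_gt0 mul0r.
rewrite pmulr_rle0 // -/(modulus (x i)) => le0; apply/eqP; apply: contraTT le0.
by rewrite -modulus_gt0 -ltNge => xi; rewrite exprn_gt0.
Qed.

Variable U : set_system nat.
Context {UU : UltraFilter U}.
Hypothesis freeU : forall N : nat, U [set j | (N <= j)%N].

(** A limit of zeros of the systems with parameters tending to [0] is a zero
    of the system with parameter [0]. There [E] vanishes, except at the
    origin, near which all zeros are at the origin. *)
Lemma zeros_separated (E : {mpoly R[i][n]}) q (s : nat -> R) (x : nat -> 'I_n -> R[i]) e :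
  in_ideal (G 0) (E * (1 - E)) -> (forall i, in_ideal (G 0) (('X_i * E) ^+ q)) ->
  (0 < q)%N -> (forall j, 0 <= s j < j.+1%:R^-1) ->
  (forall j k, (G (s j) k).@[x j] = 0) -> 0 < e ->
  U [set j | (forall i, x j i = 0) \/ modulus E.@[x j] < e].
Proof.
move=> EE EX q_gt0 s_lt Gx e0.
have [//|bad] := in_ultra_setVsetC [set j | (forall i, x j i = 0) \/ modulus E.@[x j] < e] UU.
have {bad} : U [set j | ~ (forall i, x j i = 0) /\ e <= modulus E.@[x j]].
  apply: filterS bad => j /= /not_orP[nx0 /negP]; rewrite -leNgt; by split.
move=> bad; have [B BP] := zeros_bounded.
have sj1 j : 0 <= s j <= 1.
  have /andP[-> /ltW /le_trans] := s_lt j; apply.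
  by rewrite invf_le1 ?ltr0n // ler1n.
have /choice[y y_lim] i : exists l, tends U (x^~ i) l.
  apply: (@complex_bounded_tends U _ R _ B).
  by apply: filterS filterT => j _ /=; apply: BP (sj1 j) (Gx j) i.
have s_lim : tends U (fun j => (s j)%:C%C) 0.
  apply/tends_complexP => d /(ultra_inv_nat freeU); apply: filterS => j /=.
  have /andP[s0 sj] := s_lt j; rewrite subr0 modulus_real ger0_norm //.
  exact: lt_trans.
have Gy k : (G 0 k).@[y] = 0.
  rewrite deformation_eval.
  apply: (@tends_unique U _ _ (fun j => (G (s j) k).@[x j])); last first.
    have : tends U (fun=> 0 : R[i]) 0 by exact: tends_cst.
    by apply: tends_ae; apply: filterS filterT => j _ /=; rewrite Gx.
  have : tends U (fun j => (F k).@[x j] + (s j)%:C%C * x j k ^+ D + x j k ^+ M)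
    ((F k).@[y] + 0 * y k ^+ D + y k ^+ M).
    have Fy := @tends_meval U UU _ _ (F k) _ _ y_lim.
    have yX d := @tends_exp U UU _ _ _ d (y_lim k).
    exact: (tendsD (tendsD Fy (tendsM s_lim (yX D))) (yX M)).
  by apply: tends_ae; apply: filterS filterT => j _ /=; rewrite deformation_eval.
have Ey_neq0 : E.@[y] != 0.
  rewrite -modulus_gt0; apply: lt_le_trans e0 _; rewrite leNgt; apply/negP => lt_e.
  have : tends U (fun j => modulus E.@[x j]) (modulus E.@[y]).
    exact: (tends_modulus (@tends_meval U UU _ _ E _ _ y_lim)).
  rewrite -subr_gt0 in lt_e; move=> /tendsP/(_ _ lt_e).
  move=> /(filterI bad)/ultra_ex[j [[_ le_e]]] /= /ltr_normlW.
  by rewrite ltrD2r ltNge le_e.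
have y0 i : y i = 0.
  have /eqP := in_ideal_eval (EX i) Gy; rewrite rmorphXn /= mevalM mevalXU.
  by rewrite expf_eq0 q_gt0 /= mulf_eq0 (negPf Ey_neq0) orbF => /eqP.
have m_gt0 : 0 < Num.min 1 (c / 2) :> R by rewrite lt_min ltr01 divr_gt0.
have x_small : U [set j | forall i, i \in enum 'I_n -> modulus (x j i) < Num.min 1 (c / 2)].
  apply: ultra_all => i _; have /tends_complexP/(_ _ m_gt0) := y_lim i.
  by apply: filterS => j /=; rewrite y0 subr0.
have c2 : 0 < c / 2 by rewrite divr_gt0.
have [j [[/= sjc xj] [nx _]]] :=
  ultra_ex (filterI (filterI (ultra_inv_nat freeU c2) x_small) bad).
case: nx; apply: (no_small_zeros _ _ (Gx j)).
  by have /andP[-> /lt_trans->] := s_lt j.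
by move=> i; apply: xj; rewrite mem_enum.
Qed.

End Zeros.

(** * The codimension bound *)

Section LocalBound.
Variables (R : realType) (n : nat) (F : 'I_n -> {mpoly R[i][n]}) (D : nat) (c : R).
Hypothesis c_gt0 : 0 < c.
Hypothesis D_gt0 : (0 < D)%N.
Hypothesis F0 : forall k, (F k).@[fun=> 0] = 0.
Hypothesis loja : forall p : 'I_n -> R[i], (forall i, modulus (p i) < c) ->
  exists k, forall i, c * modulus (p i) ^+ D <= modulus (F k).@[p].

(** The rank [r] of the multiplication by [E] at [s = 0] is the limit of its
    traces at the parameters [s j], that is of the sums of the values of [E]
    at the zeros; at almost all [j] each zero contributes [1], if it is the
    origin, or less than [1 / (2 q)]. So [r] is at most the multiplicity
    [z j] of the origin at [s j], which the choice of the parameters bounds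
    by [D ^ n]. *)
Lemma codim_thickened N : codim_le (thickened F N) (D ^ n).
Proof.
pose M := maxn N (maxn D.+1 (\max_k msize (F k))).
have lt_DM : (D < M)%N by rewrite /M !leq_max leqnn orbT.
have le_NM : (N <= M)%N by rewrite leq_max leqnn.
have M_gt0 : (0 < M)%N by apply: leq_ltn_trans lt_DM.
have sizeF k : (msize (F k) <= M)%N.
  by rewrite /M !leq_max (@leq_bigmax _ (fun k => msize (F k)) k) !orbT.
have [q [b [NF [NFP trP]]]] := normal_form_family lt_DM sizeF.
pose G (s : R) := deformation F M D s%:C%C.
have G0_0 s k : (G s k).@[fun=> 0] = 0.
  by rewrite deformation_eval F0 !expr0n !eqn0Ngt D_gt0 M_gt0 mulr0 !addr0.
have q_gt0 : (0 < q)%N.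
  rewrite lt0n; apply/eqP => q0; have I1 : in_ideal (G 0) 1.
    by apply: (NF_eq0 (NFP _)); apply/rowP => j; have : (j < 0)%N by rewrite -q0.
  by have /eqP := in_ideal_eval I1 (G0_0 0); rewrite meval1 oner_eq0.
have [p0 [_ tr0 nil0]] := zeros_with_multiplicity (NFP (0 : R)%:C%C).
have [E [E0 EE Ep EX]] := origin_idempotent nil0 q_gt0.
set r := \rank (mult_mx b (NF (0 : R)%:C%C) E).
have codF : codim_le (thickened F N) r.
  apply: codim_le_sub (codim_le_rank (NFP _) E0 EE N) => f [g Ng [u Ef]].
  exists (g + \sum_k u k * 'X_k ^+ M).
    apply: ord_geD => //; apply: (big_ind (ord_ge N)); first exact: ord_ge0.
      exact: ord_geD.
    move=> k _ m lt_mN; rewrite -(addn0 N) in lt_mN.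
    rewrite mulrC (@ord_geM _ _ N 0 _ _ _ _ m lt_mN) // => m' lt_m'N.
    rewrite mcoeffXn; case: eqP => // Em; move: lt_m'N.
    by rewrite -Em mdegMn mdeg1 mul1n ltnNge le_NM.
  exists u; rewrite opprD addrA Ef -sumrB; apply: eq_bigr => k _.
  by rewrite /deformation scale0r addr0 mulrDr addrK.
apply: codim_le_leq codF.
have [t tE] := trP E.
have r_tr : t.[(0 : R)%:C%C] = r%:R by rewrite -tE (rank_idempotent (NFP _) EE).
pose N' := (n * q).+1.
have /choice[d dP] (j : nat) : exists d : nat, (j.+1 < d)%N /\
    codim_le (thickened (deformation F M D d%:R^-1) N') (D ^ n).
  by have [d lt_jd cd] := codim_deformation F M D_gt0 N' j.+2; exists d.
pose s j : R := (d j)%:R^-1.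
have s_lt j : 0 <= s j < j.+1%:R^-1.
  have [lt_jd _] := dP j.
  rewrite /s invr_ge0 ler0n ltf_pV2 ?posrE ?ltr0n ?ltr_nat //.
  exact: leq_ltn_trans lt_jd.
have sE j : (s j)%:C%C = (d j)%:R^-1 by rewrite /s fmorphV rmorph_nat.
have /choice[P PP] j := zeros_with_multiplicity (NFP (s j)%:C%C).
pose z j := #|[pred a | at_origin (P j) a]|.
have sum_origin (p : 'I_q -> 'I_n -> R[i]) :
    \sum_a (at_origin p a)%:R = #|[pred a | at_origin p a]|%:R :> R[i].
  rewrite -sum1_card natr_sum [RHS]big_mkcond; apply: eq_bigr => a _.
  by rewrite inE; case: at_origin.
have le_zD j : (z j <= D ^ n)%N.
  have [Gz trz nilz] := PP j.
  have [E' [_ EE' Ep' EX']] := origin_idempotent nilz q_gt0.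
  have := rank_idempotent (NFP _) EE'; rewrite trz.
  rewrite (eq_bigr (fun a => (at_origin (P j) a)%:R)) // sum_origin -/(z j).
  move=> /eqP; rewrite eqr_nat => /eqP ->.
  apply: (rank_le_codim (NFP _) EE' q_gt0 (ltnSn _) EX').
  by rewrite sE; case: (dP j).
have [U [UU freeU]] := free_ultrafilter_exists.
pose e : R := (2 * q)%:R^-1.
have e_gt0 : 0 < e by rewrite invr_gt0 ltr0n muln_gt0.
have sep : U [set j | forall a, a \in enum 'I_q ->
    (forall i, P j a i = 0) \/ modulus E.@[P j a] < e].
  apply: (@ultra_all U _ _ _ (fun a j =>
    (forall i, P j a i = 0) \/ modulus E.@[P j a] < e)) => a _.
  apply: (zeros_separated lt_DM sizeF c_gt0 D_gt0 loja freeU EE EX q_gt0 s_lt _ e_gt0).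
  by move=> j k; case: (PP j) => Gz _ _; exact: Gz.
have s_lim : tends U (fun j => (s j)%:C%C) (0 : R)%:C%C.
  apply/tends_complexP => d' /(ultra_inv_nat freeU); apply: filterS => j /=.
  have /andP[s0 sj] := s_lt j.
  rewrite -rmorphB subr0 modulus_real ger0_norm //; exact: lt_trans.
have t_lim : tends U (fun j => t.[(s j)%:C%C]) t.[(0 : R)%:C%C].
  rewrite horner_coef.
  have : tends U (fun j => \sum_(i < size t) t`_i * (s j)%:C%C ^+ i)
                 (\sum_(i < size t) t`_i * (0 : R)%:C%C ^+ i).
    apply: tends_sum => i _; apply: tendsM; first exact: tends_cst.
    exact: (@tends_exp U UU _ _ _ i s_lim).
  by apply: tends_ae; apply: filterS filterT => j _ /=; rewrite horner_coef.
have half_gt0 : 0 < 1 / 2 :> R by rewrite divr_gt0.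
have /tends_complexP/(_ _ half_gt0) := t_lim.
move=> /(filterI sep)/ultra_ex[j [/= sepj]].
have [_ trj _] := PP j.
rewrite r_tr -tE trj => lt_half.
apply: leq_trans (le_zD j).
have close : modulus (\sum_a E.@[P j a] - (z j)%:R) <= 1 / 2.
  rewrite -sum_origin -sumrB; apply: le_trans (modulus_sum _ _) _.
  apply: le_trans (_ : \sum_(a < q) e <= _); last first.
    rewrite sumr_const card_ord -[leLHS]mulr_natr /e natrM invfM -mulrA mulVf.
      by rewrite mulr1 div1r.
    by rewrite pnatr_eq0 -lt0n.
  apply: ler_sum => a _; have [P0|lt_e] := sepj a (mem_enum _ a).
    have -> : at_origin (P j) a by apply/forallP => i; rewrite P0.
    rewrite (_ : E.@[P j a] = 1) ?subrr; last by rewrite -E0; apply: meval_eq.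
    by rewrite /modulus normr0 ltW.
  have [/forallP P0|_] := boolP (at_origin (P j) a); last by rewrite subr0 ltW.
  rewrite (_ : E.@[P j a] = 1) ?subrr; last by rewrite -E0; apply: meval_eq => i; exact/eqP.
  by rewrite /modulus normr0 ltW.
rewrite -ltnS -(ltr_nat R) -natr1 -ltrBlDl.
apply: le_lt_trans (_ : modulus (r%:R - (z j)%:R) < 1).
  rewrite -(rmorph_nat (real_complex R)) -(rmorph_nat (real_complex R) (z j)).
  by rewrite -rmorphB modulus_real ler_norm.
rewrite -(subrK (\sum_a E.@[P j a]) r%:R) -addrA.
apply: le_lt_trans (modulusD _ _) _.
by rewrite -modulusN opprB; lra.
Qed.

End LocalBound.

(** * Spanning the local ring *)

Lemma exists_left_kernel (K : fieldType) (m d : nat) (B : 'M[K]_(m, d)) :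
  (d < m)%N -> exists2 a : 'rV[K]_m, a != 0 & a *m B = 0.
Proof.
move=> lt_dm; have /rowV0Pn[a /sub_kermxP aB a0] : kermx B != 0.
  by rewrite kermx_eq0 /row_free neq_ltn (leq_ltn_trans (rank_leq_col B)).
by exists a.
Qed.

Section Nakayama.
Variables (K : fieldType) (n : nat) (F : 'I_n -> {mpoly K[n]}) (d : nat).
Implicit Types (f g : {mpoly K[n]}) (m : 'X_{1..n}).

Lemma ord_ge_leq N N' f : (N' <= N)%N -> ord_ge N f -> ord_ge N' f.
Proof. by move=> le_NN Nf m lt_m; apply: Nf; apply: leq_trans le_NN. Qed.

Lemma ord_geZ N c f : ord_ge N f -> ord_ge N (c *: f).
Proof. by move=> Nf m lt_m; rewrite mcoeffZ Nf ?mulr0. Qed.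

Lemma thickenedD N f g : thickened F N f -> thickened F N g -> thickened F N (f + g).
Proof.
move=> [f1 Nf If] [g1 Ng Ig]; exists (f1 + g1); first exact: ord_geD.
by rewrite opprD addrACA; exact: in_idealD.
Qed.

Lemma thickenedZ N c f : thickened F N f -> thickened F N (c *: f).
Proof.
move=> [f1 Nf If]; exists (c *: f1); first exact: ord_geZ.
by rewrite -scalerBr; exact: in_idealZ.
Qed.

Lemma thickened_sum N (I : Type) (r : seq I) (P : pred I) (f : I -> {mpoly K[n]}) :
  (forall i, P i -> thickened F N (f i)) -> thickened F N (\sum_(i <- r | P i) f i).
Proof.
move=> Nf; apply: (big_ind (thickened F N)) => //; last exact: thickenedD.
by exists 0; [exact: ord_ge0 | rewrite subrr; exact: in_ideal0].
Qed.

Lemma ord_ge_thickened N f : ord_ge N f -> thickened F N f.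
Proof. by move=> Nf; exists f => //; rewrite subrr; exact: in_ideal0. Qed.

Hypothesis codimF : forall N, codim_le (thickened F N) d.

(** Otherwise for each [j <= d] some [f j] in the [j]-th power of the
    maximal ideal is not in the next power plus the ideal of [F]. In
    dimension at most [d] these [d + 1] elements satisfy a linear relation,
    which puts the first one with a nonzero coefficient there after all. *)
Lemma chain_stabilizes : exists j, forall f, ord_ge j f -> thickened F j.+1 f.
Proof.
apply: contrapT => nstab.
have /choice[f fP] (j : 'I_d.+1) :
    exists f, ord_ge j f /\ ~ thickened F j.+1 f.
  apply: contrapT => nf; apply: nstab; exists j => f jf.
  by apply: contrapT => njf; apply: nf; exists f.
have [e eP] := codimF d.+1.
have /choice[c cP] j := eP (f j).
pose B := \matrix_(j < d.+1, i < d) c j i.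
have [a a0 aB] := exists_left_kernel B (ltnSn d).
have aI : thickened F d.+1 (\sum_j a 0 j *: f j).
  have -> : \sum_j a 0 j *: f j = \sum_j a 0 j *: (f j - \sum_i c j i *: e i).
    apply/eqP; rewrite -subr_eq0 -sumrB.
    rewrite (eq_bigr (fun j => \sum_i (a 0 j * B j i) *: e i)).
      rewrite exchange_big big1 //= => i _; rewrite -scaler_suml.
      by have /rowP/(_ i) := aB; rewrite !mxE => ->; rewrite scale0r.
    move=> j _; rewrite -scalerBr subKr scaler_sumr; apply: eq_bigr => i _.
    by rewrite mxE scalerA.
  by apply: thickened_sum => j _; apply: thickenedZ.
have [j0 aj0] : exists j, a 0 j != 0 by apply/rV0Pn.
case: (@arg_minnP _ j0 (fun j => a 0 j != 0) val aj0) => j aj jmin.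
apply: (fP j).2.
have weaken N N' g : (N' <= N)%N -> thickened F N g -> thickened F N' g.
  by move=> le_NN [g1 /(ord_ge_leq le_NN)]; exists g1.
have -> : f j = (a 0 j)^-1 *: (\sum_i a 0 i *: f i
                               + (-1) *: \sum_(i | i != j) a 0 i *: f i).
  by rewrite (bigD1 j) //= scaleN1r addrK scalerA mulVf // scale1r.
apply: thickenedZ; apply: thickenedD; first by apply: weaken aI; exact: ltn_ord.
apply: thickenedZ; apply: thickened_sum => i ne_ij.
have [->|ai] := eqVneq (a 0 i) 0.
  by rewrite scale0r; apply: ord_ge_thickened; exact: ord_ge0.
apply/ord_ge_thickened/ord_geZ; apply: ord_ge_leq (fP i).1.
by rewrite ltn_neqAle eq_sym (inj_eq val_inj) ne_ij; exact: jmin.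
Qed.

Lemma submonomial j m : (j <= mdeg m)%N -> exists2 a, (a <= m)%MM & mdeg a = j.
Proof.
move=> le_jm; have [k Ek] : exists k, mdeg m = (j + k)%N.
  by exists (mdeg m - j)%N; rewrite subnKC.
elim: k m {le_jm} Ek => [|k IHk] m Em.
  by exists m; rewrite ?Em ?addn0 //; exact: lepm_refl.
have [i mi] : exists i, m i != 0%N.
  apply/existsP; rewrite -negb_forall; apply/negP => /forallP m0.
  by move: Em; rewrite mdegE big1 ?addnS // => i _; exact/eqP.
have le_im : (U_(i) <= m)%MM by rewrite lep1mP.
have [|a le_a <-] := IHk (m - U_(i))%MM.
  by apply/eqP; rewrite -(eqn_add2r 1) -{1}(mdeg1 i) -mdegD submK // Em addnS addn1.
by exists a => //; apply: lepm_trans le_a (lem_subr _ _).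
Qed.

(** The monomials of degree [j] generate the [j]-th power of the maximal
    ideal, and on the next power the coefficients can be taken in the
    maximal ideal. *)
Lemma ord_ge_decompose j f : ord_ge j f ->
  exists h : 'X_{1..n < j.+1} -> {mpoly K[n]},
    f = \sum_(a : 'X_{1..n < j.+1} | mdeg a == j) h a * 'X_[a] /\
    (ord_ge j.+1 f -> forall a, (h a).@[fun=> 0] = 0).
Proof.
move=> jf; have /choice[s sP] (m : 'X_{1..n}) : exists a : 'X_{1..n < j.+1},
    (j <= mdeg m)%N -> (a <= m)%MM /\ mdeg a == j.
  have [le_jm|lt_mj] := leqP j (mdeg m); last by exists bm0.
  have [a le_am Ea] := submonomial le_jm.
  have lt_a : (mdeg a < j.+1)%N by rewrite Ea.
  by exists (BMultinom lt_a); rewrite /= Ea.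
exists (fun a => \sum_(m <- msupp f | s m == a) f@_m *: 'X_[m - s m]); split.
  under eq_bigr do rewrite mulr_suml.
  rewrite (exchange_big_dep xpredT) //= {1}[f]mpolyE; apply: eq_big_seq => m Fm.
  have [le_jm|lt_mj] := leqP j (mdeg m); last first.
    by move: Fm; rewrite mcoeff_msupp jf ?eqxx.
  have [le_sm Es] := sP m le_jm.
  rewrite (big_pred1 (s m)) => [|a]; last first.
    by apply/idP/eqP => [/andP[_ /eqP->]|->] //; rewrite Es eqxx.
  by rewrite -scalerAl -mpolyXD submK.
move=> j1f a; rewrite raddf_sum big_seq_cond big1 //= => m /andP[Fm _].
have [lt_mj|le_jm] := ltnP (mdeg m) j.+1.
  by move: Fm; rewrite mcoeff_msupp j1f ?eqxx.
have [le_sm /eqP Es] := sP m (ltnW le_jm).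
rewrite mevalZ meval_origin mcoeffX; case: eqP; rewrite ?mulr0 // => m0.
by move: le_jm; rewrite -(submK le_sm) m0 add0m Es ltnn.
Qed.

(** Nakayama's lemma in the local ring, by Cramer's rule for the monomials of
    degree [j]; the factor [u] is the determinant. *)
Lemma power_in_local_ideal : exists j u, u.@[fun=> 0] != 0 /\
  forall f, ord_ge j f -> in_ideal F (u * f).
Proof.
have [j jP] := chain_stabilizes; exists j.
pose A : {pred 'X_{1..n < j.+1}} := [pred a : 'X_{1..n < j.+1} | mdeg a == j].
pose t (i : 'I_#|A|) : 'X_{1..n} := enum_val i.
have degt i : mdeg (t i) = j by apply/eqP; exact: (enum_valP i).
have sumT (h : 'X_{1..n < j.+1} -> {mpoly K[n]}) :
    \sum_(a : 'X_{1..n < j.+1} | mdeg a == j) h a * 'X_[a]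
  = \sum_(i < #|A|) h (enum_val i) * 'X_[t i].
  exact: (big_enum_val (A := A) (fun a => h a * 'X_[bmnm a])).
have /choice[h hP] (i : 'I_#|A|) : exists h : 'I_#|A| -> {mpoly K[n]},
    in_ideal F ('X_[t i] - \sum_l h l * 'X_[t l]) /\ forall l, (h l).@[fun=> 0] = 0.
  have [|g jg Ig] := jP 'X_[t i].
    by move=> m; rewrite mcoeffX -{1}(degt i); case: eqP => // ->; rewrite ltnn.
  have [h [Eg h0]] := ord_ge_decompose (ord_ge_leq (leqnSn _) jg).
  exists (fun l => h (enum_val l)); split; last by move=> l; exact: h0.
  by rewrite -sumT -Eg.
pose B : 'M[{mpoly K[n]}]_#|A| := \matrix_(i, l) ((i == l)%:R - h i l).
pose w : 'cV[{mpoly K[n]}]_#|A| := \col_l 'X_[t l].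
have Bw i : in_ideal F ((B *m w) i 0).
  have [Ih _] := hP i; rewrite mxE.
  rewrite (_ : \sum_l _ = 'X_[t i] - \sum_l h i l * 'X_[t l]) //.
  rewrite (eq_bigr (fun l => (i == l)%:R * 'X_[t l] - h i l * 'X_[t l])).
    rewrite sumrB (bigD1 i) //= eqxx mul1r big1 ?addr0 // => l.
    by rewrite eq_sym => /negPf->; rewrite mul0r.
  by move=> l _; rewrite !mxE mulrBl.
exists (\det B); split.
  rewrite -det_map_mx (_ : map_mx _ B = 1%:M) ?det1 ?oner_eq0 //.
  apply/matrixP => i l; rewrite !mxE /= mevalB (hP i).2 subr0.
  by case: eqP => _; rewrite ?meval1 ?meval0.
have detw i : in_ideal F (\det B * 'X_[t i]).
  have -> : \det B * 'X_[t i] = (\adj B *m (B *m w)) i 0.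
    by rewrite mulmxA mul_adj_mx mul_scalar_mx !mxE.
  by rewrite mxE; apply: in_ideal_sum => l; apply: in_idealMl.
move=> f jf; have [h' [-> _]] := ord_ge_decompose jf.
rewrite sumT mulr_sumr; apply: in_ideal_sum => i.
by rewrite mulrCA; apply: in_idealMl.
Qed.

End Nakayama.

Section LocalRing.
Variables (R : realType) (n : nat) (F : 'I_n -> {mpoly R[i][n]}).
Variable (p : 'I_n -> R[i]).
Local Notation frac := {fraction {mpoly R[i][n]}}.
Implicit Types (f g : {mpoly R[i][n]}) (h : frac).
Local Notation inL := (local_ring p).
Local Notation inI := (local_ideal F p).
Local Notation scal c := (tofrac (c%:MP_[n])).

Lemma tofrac_neq0 g : g.@[p] != 0 -> tofrac g != 0.
Proof. by rewrite tofrac_eq0; apply: contraNneq => ->; rewrite meval0. Qed.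

Lemma local_ring_tofrac f : inL (tofrac f).
Proof.
by exists f, 1; rewrite meval1 oner_neq0 tofrac1 divr1.
Qed.

Lemma local_ringD h1 h2 : inL h1 -> inL h2 -> inL (h1 + h2).
Proof.
move=> [f1 [g1 [g1p ->]]] [f2 [g2 [g2p ->]]].
exists (f1 * g2 + f2 * g1), (g1 * g2); rewrite mevalM mulf_neq0 //; split=> //.
by rewrite addf_div ?tofrac_neq0 // tofracD !tofracM.
Qed.

Lemma local_ringM h1 h2 : inL h1 -> inL h2 -> inL (h1 * h2).
Proof.
move=> [f1 [g1 [g1p ->]]] [f2 [g2 [g2p ->]]].
exists (f1 * f2), (g1 * g2); rewrite mevalM mulf_neq0 //; split=> //.
by rewrite mulf_div !tofracM.
Qed.

Lemma local_ideal_frac a u : in_ideal F a -> u.@[p] != 0 -> inI (tofrac a / tofrac u).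
Proof.
move=> [v ->] up; exists (fun k => tofrac (v k) / tofrac u).
  by move=> k; exists (v k), u.
rewrite rmorph_sum mulr_suml; apply: eq_bigr => k _ /=.
by rewrite tofracM mulrAC.
Qed.

Lemma local_ideal0 : inI 0.
Proof.
rewrite -(mul0r (tofrac 1)^-1) -tofrac0; apply: local_ideal_frac.
  exact: in_ideal0.
by rewrite meval1 oner_neq0.
Qed.

Lemma local_idealD h1 h2 : inI h1 -> inI h2 -> inI (h1 + h2).
Proof.
move=> [u1 L1 ->] [u2 L2 ->]; exists (fun k => u1 k + u2 k).
  by move=> k; exact: local_ringD.
by rewrite -big_split; apply: eq_bigr => k _; rewrite mulrDl.
Qed.

Lemma local_idealM h1 h2 : inL h1 -> inI h2 -> inI (h1 * h2).
Proof.
move=> L1 [u2 L2 ->]; exists (fun k => h1 * u2 k).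
  by move=> k; exact: local_ringM.
by rewrite mulr_sumr; apply: eq_bigr => k _; rewrite mulrA.
Qed.

Lemma local_idealZ (c : R[i]) h : inI h -> inI (scal c * h).
Proof. by apply: local_idealM; exact: local_ring_tofrac. Qed.

Lemma local_idealB h1 h2 : inI h1 -> inI h2 -> inI (h1 - h2).
Proof.
move=> I1 I2; apply: local_idealD => //.
by rewrite -mulN1r -tofrac1 -tofracN; apply: local_idealM => //; exact: local_ring_tofrac.
Qed.

Lemma local_ideal_sum (I : finType) (P : pred I) (h : I -> frac) :
  (forall i, P i -> inI (h i)) -> inI (\sum_(i | P i) h i).
Proof.
by move=> Ih; apply: (big_ind inI) => //; [exact: local_ideal0 | exact: local_idealD].
Qed.

Definition local_span d (e : 'I_d -> frac) : Prop :=
  (forall i, inL (e i)) /\ forall h, inL h -> exists c : 'rV[R[i]]_d,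
    inI (h - \sum_(i < d) scal (c 0 i) * e i).

(** A basis with more elements than a spanning family has a nontrivial
    relation in its matrix of coordinates. *)
Lemma local_dim_le_span d d' (e : 'I_d -> frac) :
  local_span e -> local_algebra_has_dim F p d' -> (d' <= d)%N.
Proof.
move=> [Le eP] [e' Le' e'P]; rewrite leqNgt; apply/negP => lt_dd.
have /choice[c cP] i := eP _ (Le' i).
pose B := \matrix_(i < d', l < d) c i 0 l.
have [a a0 aB] := exists_left_kernel B lt_dd.
have L0 : inL 0 by rewrite -tofrac0; exact: local_ring_tofrac.
have [c0 [_ c0_uniq]] := e'P 0 L0.
move/eqP: a0; apply; rewrite -(c0_uniq a); last first.
  have -> : 0 - \sum_(i < d') scal (a 0 i) * e' i
          = \sum_(i < d') scal (- a 0 i) * (e' i - \sum_(l < d) scal (c i 0 l) * e l).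
    rewrite sub0r -sumrN.
    have -> : \sum_(i < d') scal (- a 0 i) * (e' i - \sum_(l < d) scal (c i 0 l) * e l)
        = \sum_(i < d') - (scal (a 0 i) * e' i)
        + \sum_(l < d) scal ((a *m B) 0 l) * e l.
      rewrite (eq_bigr (fun i => - (scal (a 0 i) * e' i)
                 + \sum_(l < d) scal (a 0 i * B i l) * e l)); last first.
        move=> i _; rewrite mpolyCN tofracN mulNr mulrBr opprB addrC mulr_sumr.
        congr (_ + _); apply: eq_bigr => l _.
        by rewrite mxE mpolyCM tofracM mulrA.
      rewrite big_split; congr (_ + _); rewrite exchange_big.
      by apply: eq_bigr => l _; rewrite mxE !rmorph_sum /= mulr_suml.
    rewrite aB [X in _ + X]big1 ?addr0 // => l _.
    by rewrite mxE mpolyC0 tofrac0 mul0r.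
  by apply: local_ideal_sum => i _; apply: local_idealZ.
apply: c0_uniq; rewrite big1 ?subr0; first exact: local_ideal0.
by move=> i _; rewrite mxE mpolyC0 tofrac0 mul0r.
Qed.

(** A spanning family of least size is a basis: a relation would express one
    element by the others. *)
Lemma local_algebra_dim_le d (e : 'I_d -> frac) : local_span e ->
  exists2 d', (d' <= d)%N & local_algebra_has_dim F p d'.
Proof.
move=> eP; pose spanning k := `[< exists e : 'I_k -> frac, local_span e >].
have ex_span : exists k, spanning k by exists d; apply/asboolP; exists e.
have [k /asboolP[e0 [Le0 e0P]] kmin] := ex_minnP ex_span.
exists k; first by apply: kmin; apply/asboolP; exists e.
exists e0 => // h Lh; have [c Ic] := e0P h Lh; exists c; split=> // c' Ic'.
apply/rowP => i; apply/eqP; apply: contraT => ne_ci.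
pose a l := c 0 l - c' 0 l.
have ai : a i != 0 by rewrite subr_eq0.
have Ia : inI (\sum_l scal (a l) * e0 l).
  have := local_idealB Ic' Ic.
  have cancel x y z : x - y - (x - z) = z - y :> frac by ring.
  rewrite cancel -sumrB.
  by congr inI; apply: eq_bigr => l _; rewrite /a mpolyCB tofracB mulrBl.
case: k => [|k] in e0 Le0 e0P kmin c Ic c' Ic' i ne_ci a ai Ia *.
  by case: i ne_ci {ai}.
have : spanning k; last by move/kmin; rewrite ltnn.
apply/asboolP; exists (fun l => e0 (lift i l)); split=> [l|h1 /e0P[b Ib]].
  exact: Le0.
exists (\row_l (b 0 (lift i l) - b 0 i / a i * a (lift i l))).
have Iab := local_idealZ (b 0 i / a i) Ia.
have := local_idealD Ib Iab; congr inI.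
rewrite !(bigD1_ord i) //=.
rewrite [in RHS](eq_bigr (fun l => scal (b 0 (lift i l)) * e0 (lift i l)
    - scal (b 0 i / a i) * (scal (a (lift i l)) * e0 (lift i l)))); last first.
  by move=> l _; rewrite mxE mpolyCB mpolyCM tofracB tofracM mulrBl mulrA.
rewrite sumrB -mulr_sumr mulrDr mulrA -tofracM -mpolyCM divfK //.
set S := \sum_l _; set T := \sum_l _; ring.
Qed.

End LocalRing.

Section MultiplicityBound.
Variables (R : realType) (n : nat) (F : 'I_n -> {mpoly R[i][n]}) (d : nat).
Hypothesis codimF : forall N, codim_le (thickened F N) d.

(** Modulo the [j]-th power of the maximal ideal a denominator
    [g = c0 * (1 - y)] is inverted by the geometric series of [y]; that
    power lies in the local ideal. *)
Lemma local_span_exists : exists e : 'I_d -> {fraction {mpoly R[i][n]}},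
  local_span F (fun=> 0) e.
Proof.
have [j [u [u0 uI]]] := power_in_local_ideal codimF.
have [e eP] := codimF j; exists (fun i => tofrac (e i)).
split=> [i|_ [f [g [g0 ->]]]]; first exact: local_ring_tofrac.
pose c0 := g.@[fun=> 0]; pose y := 1 - c0^-1 *: g.
have y0 : y.@[fun=> 0] = 0 by rewrite mevalB meval1 mevalZ mulVf ?subrr.
have [S ES] : exists S, 1 - y ^+ j = (1 - y) * S.
  by eexists; rewrite -{1}(expr1n _ j) subrXX.
pose g' := c0^-1 *: S.
have gg' : g * g' = 1 - y ^+ j by rewrite ES /g' -scalerAr scalerAl /y subKr.
have [c [w jw Iw]] := eP (f * g').
exists (\row_i c i).
pose s := \sum_i c i *: e i.
have -> : \sum_(i < d) tofrac (((\row_i c i) 0 i)%:MP_[n]) * tofrac (e i) = tofrac s.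
  rewrite rmorph_sum; apply: eq_bigr => i _ /=.
  by rewrite mxE -tofracM mul_mpolyC.
have -> : tofrac f / tofrac g - tofrac s = tofrac (u * (f - g * s)) / tofrac (u * g).
  rewrite !tofracM tofracB tofracM -mulf_div divff ?(tofrac_neq0 u0) // mul1r.
  by rewrite mulrBl mulrAC divff ?(tofrac_neq0 g0) // mul1r.
apply: local_ideal_frac; last by rewrite mevalM mulf_neq0.
have -> : u * (f - g * s)
    = u * (f * y ^+ j) + (u * g) * (f * g' - s - w) + u * (g * w).
  have -> : y ^+ j = 1 - g * g' by rewrite gg' subKr.
  by ring.
have ord0 (v : {mpoly R[i][n]}) : ord_ge 0 v by [].
apply: in_idealD.
  apply: in_idealD; last exact: in_idealMl.
  apply: uI; rewrite -(add0n j) -[X in ord_ge (_ + X) _]muln1.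
  by apply: ord_geM => //; apply/ord_ge_exp/ord_ge1.
by apply: uI; rewrite -(add0n j); apply: ord_geM.
Qed.

Lemma local_multiplicity_le : (local_multiplicity F (fun=> 0%R) <= (d%:R)%:E)%E.
Proof.
have [e span_e] := local_span_exists.
have [d' _ dim_d'] := local_algebra_dim_le span_e.
rewrite /local_multiplicity; case: xgetP => [_ -> [k dim_k <-]|].
  by rewrite lee_fin ler_nat; exact: local_dim_le_span span_e dim_k.
by move=> /(_ (d'%:R)%:E) []; exists d'.
Qed.

End MultiplicityBound.

(** * The bound on the multiplicity *)

Theorem corollary3p11 (R : realType) (n m : nat)
    (C : 'M[R[i]]_(n, (n + m).+1)) (A : 'M[nat]_(n.+1, (n + m).+1))
    (mu : \bar R) :
  (1 <= n)%N -> (1 <= m)%N ->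
  \rank C = n ->
  \rank (map_mx (fun a : nat => a%:R : rat) A) = n.+1 ->
  (forall j, A ord0 j = 1%N) ->
  injective (fun j => col j A) ->
  convenient_system (shifted_system C A) ->
  nondegenerate_at_origin (shifted_system C A) ->
  local_multiplicity (shifted_system C A) (fun _ => 0) = mu ->
  (mu <= (((n + m) ^ n)%N%:R)%:E)%E.
Proof.
move=> n_gt0 _ _ _ _ _ conv [[F0 _] _ nondeg] <-.
have axes k i := axis_order i (conv k).
have [c c_gt0 loja] := lojasiewicz nondeg axes.
apply: local_multiplicity_le => N.
by apply: (codim_thickened c_gt0 _ F0 loja); rewrite addn_gt0 n_gt0.
Qed.
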